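(* There is an absolute constant $C>0$ such that for every finite set $S$ of arms, every $\epsilon\in(0,1)$ and every $\delta\in(0,1/2]$ there is an algorithm which, with probability at least $1-\delta$, outputs an arm $a\in S$ with $|\theta_a-\max_{i\in S}\theta_i|\le\epsilon$ and uses at most $$C\sum_{i\in S}\Big(\frac{\sigma_i^2}{\epsilon^2}+\frac{1}{\epsilon}\Big)\big(\ln\delta^{-1}+\mathrm{LL}(\epsilon^{-1})\big)$$ samples.
   Context: Bandit model: each arm $i$, when sampled, yields an independent draw from an unknown distribution supported on $[0,1]$ with mean $\theta_i$ and variance $\sigma_i^2$. An algorithm adaptively chooses (possibly randomly) which arm of $S$ to sample based on past observations, stops and outputs an arm; the number of samples is the total number of draws. For $x\ge1$, $\mathrm{LL}(x):=\ln(e+\ln x)$. *)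

(* Defs.v *)
From HB Require Import structures.
From mathcomp Require Import all_boot all_order all_algebra.
From mathcomp Require Import all_classical all_reals all_analysis.
Set Implicit Arguments. Unset Strict Implicit. Unset Printing Implicit Defensive.
Import Order.TTheory GRing.Theory Num.Theory.
Local Open Scope ring_scope.
Local Open Scope classical_set_scope.

Section Bandit.
Variable R : realType.

Definition LL (x : R) : R := ln (expR 1 + ln x).

Definition dmean (mu : probability R R) : R := fine (\int[mu]_x (x%:E))%E.
Definition dvar (mu : probability R R) : R :=
  fine (\int[mu]_x (((x - dmean mu) ^+ 2)%:E))%E.

Definition supported01 (mu : probability R R) : Prop :=
  mu [set x : R | 0 <= x <= 1] = 1%E.

Variable k : nat. (* the arm set S is 'I_k.+1 *)

Definition hist := seq ('I_k.+1 * R).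
(* inl i = sample arm i ; inr a = stop and output arm a *)
Definition action := ('I_k.+1 + 'I_k.+1)%type.

(* randomized adaptive algorithm: given the history, a probability
   distribution over the finitely many possible next actions *)
Definition policy := hist -> action -> R.

Definition valid_policy (pol : policy) : Prop :=
  forall h, (forall a, 0 <= pol h a) /\ \sum_(a : action) pol h a = 1.

Definition theta (mu : 'I_k.+1 -> probability R R) (i : 'I_k.+1) : R :=
  dmean (mu i).

Definition maxtheta (mu : 'I_k.+1 -> probability R R) : R :=
  \big[Num.max/theta mu ord0]_(i < k.+1) theta mu i.

Definition eps_good (mu : 'I_k.+1 -> probability R R) (eps : R) (a : 'I_k.+1)
  : bool := `|theta mu a - maxtheta mu| <= eps.

(* Probability that, starting from history h, the algorithm stops after
   drawing at most m further samples and outputs an eps-good arm.  Each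
   sample of arm i is a fresh independent draw from mu i. *)
Fixpoint succ_within (pol : policy) (mu : 'I_k.+1 -> probability R R)
  (eps : R) (m : nat) (h : hist) {struct m} : \bar R :=
  (\sum_(a : action)
     ((pol h a)%:E *
      match a with
      | inr j => (eps_good mu eps j)%:R%:E
      | inl i =>
          match m with
          | O => 0
          | S m' => \int[mu i]_x succ_within pol mu eps m' (rcons h (i, x))
          end
      end))%E.

End Bandit.

(* Main.v *)
(* Observations are rounded down to a grid of mesh at most [eps / 8]; this moves
   means by at most [eps / 8] and variances by a bounded factor, and it makes an
   algorithm a finitely branching decision tree.

   The basic tool is a test on [n] pairs of observations of one arm: it accepts
   when the sum of the squared differences is below a threshold, and then
   reports the empirical mean.  Whatever the variance, acceptance with a mean off
   by [e] has probability at most [exp (- l)], because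
   [E exp (a (X + X' - 2 m) - 8 a^2 (X - X')^2) <= 1] for [|a| <= 1/8]; and
   acceptance itself is a reliable estimate of the variance.

   Every arm is first tested with batches of doubling sizes [2^j n] until
   acceptance.  The expected excess of the final batch over the ideal one is a
   fraction [exp (- l)] of the latter, so Markov's inequality bounds the total
   number of draws without a union bound over the arms.  This sorts the arms into
   [O (ln (1/eps))] levels.  Within a level all arms cost the same and median
   elimination finds an almost best arm without a logarithm of the number of
   arms.  A misclassified arm cannot win by luck, since every round repeats the
   test with fresh draws.  The level winner with the highest estimate is
   returned.  Only the levels require a union bound, whence the term [LL (1/eps)]
   in [l]. *)
Require Import Defs.
From HB Require Import structures.
From mathcomp Require Import all_boot all_order all_algebra.
From mathcomp Require Import all_classical all_reals all_analysis.
From mathcomp Require Import measurable_realfun zify ring lra.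
Import Order.TTheory GRing.Theory Num.Theory.
Local Open Scope ring_scope.
Set Implicit Arguments. Unset Strict Implicit. Unset Printing Implicit Defensive.

(** * Sampling algorithms as decision trees *)

Inductive prog (I B A : Type) : Type :=
  | Ret of A
  | Draw of I & (B -> prog I B A).
Arguments Ret {I B A}.

Section Programs.
Variables (I B : Type).

Fixpoint bind A A' (t : prog I B A) (f : A -> prog I B A') : prog I B A' :=
  match t with
  | Ret a => f a
  | Draw i g => Draw i (fun b => bind (g b) f)
  end.

(* [always t Q]: every run of [t] that makes [n] draws and returns [a]
   satisfies [Q n a]. *)
Fixpoint always A (t : prog I B A) (Q : nat -> A -> Prop) : Prop :=
  match t with
  | Ret a => Q 0%N a
  | Draw i g => forall b, always (g b) (fun n => Q n.+1)
  end.

Fixpoint traverse X A (f : X -> prog I B A) (s : seq X) : prog I B (seq (X * A)) :=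
  if s is x :: s' then
    bind (f x) (fun a => bind (traverse f s') (fun r => Ret ((x, a) :: r)))
  else Ret [::].

Lemma always_impl A (t : prog I B A) (Q Q' : nat -> A -> Prop) :
  (forall n a, Q n a -> Q' n a) -> always t Q -> always t Q'.
Proof.
elim: t Q Q' => [a|i g IH] Q Q' QQ' /=; first exact: QQ'.
by move=> tQ b; apply: IH (tQ b) => n a; apply: QQ'.
Qed.

Lemma always_true A (t : prog I B A) (Q : nat -> A -> Prop) :
  (forall n a, Q n a) -> always t Q.
Proof. by elim: t Q => [a|i g IH] Q QT //= b; apply: IH. Qed.

Lemma always_and A (t : prog I B A) (Q Q' : nat -> A -> Prop) :
  always t Q -> always t Q' -> always t (fun n a => Q n a /\ Q' n a).
Proof.
by elim: t Q Q' => [a|i g IH] Q Q' //= tQ tQ' b; apply: IH.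
Qed.

Lemma always_bind A A' (t : prog I B A) (f : A -> prog I B A')
    (Q : nat -> A -> Prop) (Q' : nat -> A' -> Prop) :
  always t Q ->
  (forall n a, Q n a -> always (f a) (fun m b => Q' (n + m)%N b)) ->
  always (bind t f) Q'.
Proof.
elim: t Q Q' => [a|i g IH] Q Q' /=; first by move=> Qa /(_ _ _ Qa).
move=> tQ QQ' b; apply: IH (tQ b) _ => n a Qa.
by apply: always_impl (QQ' _ _ Qa).
Qed.

Lemma traverse_keys X A (f : X -> prog I B A) (s : seq X) :
  always (traverse f s) (fun _ r => unzip1 r = s).
Proof.
elim: s => [//|x s IH] /=; apply: (@always_bind _ _ _ _ (fun _ _ => True)).
  exact: always_true.
by move=> n a _; apply: always_bind IH _ => m r /= ->.
Qed.

Lemma traverse_cost X A (f : X -> prog I B A) (c : X -> A -> nat) (s : seq X) :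
  (forall x, always (f x) (fun n a => n <= c x a)%N) ->
  always (traverse f s)
    (fun n r => n <= \sum_(z <- r) c z.1 z.2)%N.
Proof.
move=> fc; elim: s => [|x s IH] /=; first by rewrite big_nil.
apply: always_bind (fc x) _ => n a na; apply: always_bind IH _ => m r mr /=.
by rewrite big_cons addn0 leq_add.
Qed.

End Programs.

(** * Expectations and probabilities over the random runs of a tree *)

Section Expectation.
Variables (R : realType) (I : Type) (B : finType) (p : I -> B -> R).
Hypothesis p_ge0 : forall i b, 0 <= p i b.
Hypothesis p_sum1 : forall i, \sum_b p i b = 1.

Fixpoint ex A (t : prog I B A) (f : A -> R) : R :=
  match t with
  | Ret a => f a
  | Draw i g => \sum_b p i b * ex (g b) f
  end.

Lemma ex_bind A A' (t : prog I B A) (g : A -> prog I B A') f :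
  ex (bind t g) f = ex t (fun a => ex (g a) f).
Proof.
by elim: t => [a|i h IH] //=; apply: eq_bigr => b _; rewrite IH.
Qed.

Lemma ex_le_always A (t : prog I B A) (Q : nat -> A -> Prop) f g :
  always t Q -> (forall n a, Q n a -> f a <= g a) -> ex t f <= ex t g.
Proof.
elim: t Q => [a|i h IH] Q /= tQ fg; first exact: fg tQ.
apply: ler_sum => b _; apply: ler_wpM2l => //.
by apply: IH (tQ b) _ => n a; apply: fg.
Qed.

Lemma ex_le A (t : prog I B A) f g : (forall a, f a <= g a) -> ex t f <= ex t g.
Proof.
move=> fg; apply: (@ex_le_always _ _ (fun _ _ => True)) => //.
exact: always_true.
Qed.

Lemma eq_ex A (t : prog I B A) f g : f =1 g -> ex t f = ex t g.
Proof. by move=> fg; apply/le_anti/andP; split; apply: ex_le => a; rewrite fg. Qed.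

Lemma exD A (t : prog I B A) f g : ex t (fun a => f a + g a) = ex t f + ex t g.
Proof.
elim: t => [a|i h IH] //=; rewrite -big_split /=.
by apply: eq_bigr => b _; rewrite IH mulrDr.
Qed.

Lemma exZ A (t : prog I B A) c f : ex t (fun a => c * f a) = c * ex t f.
Proof.
elim: t => [a|i h IH] //=; rewrite big_distrr /=.
by apply: eq_bigr => b _; rewrite IH mulrCA.
Qed.

Lemma ex_cst A (t : prog I B A) c : ex t (fun=> c) = c.
Proof.
elim: t => [a|i h IH] //=; under eq_bigr do rewrite IH.
by rewrite -mulr_suml p_sum1 mul1r.
Qed.

Lemma ex_ge0 A (t : prog I B A) f : (forall a, 0 <= f a) -> 0 <= ex t f.
Proof. by move=> f0; rewrite -(ex_cst t 0); apply: ex_le. Qed.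

Lemma ex_traverse X A (f : X -> prog I B A) (g : X * A -> R) (s : seq X) :
  ex (traverse f s) (fun r => \sum_(z <- r) g z) =
  \sum_(x <- s) ex (f x) (fun a => g (x, a)).
Proof.
elim: s => [|x s IH] /=; first by rewrite !big_nil.
rewrite big_cons -IH ex_bind -[X in _ + X](ex_cst (f x)) -exD.
apply: eq_ex => a; rewrite ex_bind -[X in X + _](ex_cst (traverse f s)) -exD.
by apply: eq_ex => r /=; rewrite big_cons.
Qed.

Definition pr A (t : prog I B A) (P : pred A) : R := ex t (fun a => (P a)%:R).

Lemma prC A (t : prog I B A) P : pr t P = 1 - pr t (predC P).
Proof.
apply/esym/eqP; rewrite subr_eq -(ex_cst t 1) /pr -exD; apply/eqP/eq_ex => a /=.
by case: (P a); rewrite ?addr0 ?add0r.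
Qed.

Lemma pr_le A (t : prog I B A) (P P' : pred A) :
  (forall a, P a -> P' a) -> pr t P <= pr t P'.
Proof. by move=> PP'; apply: ex_le => a; rewrite ler_nat; case: (P a) (PP' a) => // ->. Qed.

Lemma pr_le1 A (t : prog I B A) P : pr t P <= 1.
Proof. by rewrite -(ex_cst t 1); apply: ex_le => a; rewrite lern1 leq_b1. Qed.

Lemma pr_union A (t : prog I B A) (P P1 P2 : pred A) :
  (forall a, P a -> P1 a || P2 a) -> pr t P <= pr t P1 + pr t P2.
Proof.
move=> PU; rewrite /pr -exD; apply: ex_le => a; rewrite -natrD ler_nat.
by case: (P a) (PU a) => // /(_ isT); case: (P1 a) => //=; case: (P2 a).
Qed.

(** Union bound over two phases: a run fails either through a bad first result [P], or in the second
    phase after a good one. [Q] carries the facts that hold on every run of the first phase. *)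
Lemma pr_bind_le_always A A' (t : prog I B A) (g : A -> prog I B A') Q P P' c :
  0 <= c -> always t Q ->
  (forall n a, Q n a -> ~~ P a -> pr (g a) P' <= c) ->
  pr (bind t g) P' <= pr t P + c.
Proof.
move=> c0 tQ gP; rewrite /pr ex_bind -[X in _ <= _ + X](ex_cst t c) -exD.
apply: ex_le_always tQ _ => n a Qa; case: (boolP (P a)) => Pa.
  by rewrite (le_trans (pr_le1 _ _)) // lerDl.
by rewrite add0r; apply: gP Qa Pa.
Qed.

Lemma pr_bind_le_cst A A' (t : prog I B A) (g : A -> prog I B A') P c :
  (forall a, pr (g a) P <= c) -> pr (bind t g) P <= c.
Proof. by move=> gP; rewrite /pr ex_bind -[leRHS](ex_cst t); apply: ex_le. Qed.

(** Markov's inequality for an additive score: if the event forces a total score of at least 1, its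
    probability is at most the sum of the expected scores. Every later count of misjudged arms
    passes through this bound. *)
Lemma pr_le_count X A (f : X -> prog I B A) (s : seq X) (P : pred (seq (X * A)))
    (Q : nat -> seq (X * A) -> Prop) (g : X * A -> R) :
  (forall z, 0 <= g z) -> always (traverse f s) Q ->
  (forall n r, Q n r -> P r -> 1 <= \sum_(z <- r) g z) ->
  pr (traverse f s) P <= \sum_(x <- s) ex (f x) (fun a => g (x, a)).
Proof.
move=> g0 tQ h; rewrite -ex_traverse; apply: ex_le_always tQ _ => n r Qr.
by case: (P r) (h _ _ Qr) => [/(_ isT)|_] //; apply: sumr_ge0.
Qed.

Lemma pr_bind_le A A' (t : prog I B A) (g : A -> prog I B A') P P' c :
  0 <= c -> (forall a, ~~ P a -> pr (g a) P' <= c) ->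
  pr (bind t g) P' <= pr t P + c.
Proof.
move=> c0 gP; apply: (@pr_bind_le_always _ _ _ _ (fun _ _ => True)) => //.
  exact: always_true.
by move=> _ a _; apply: gP.
Qed.

Lemma chernoff A (t : prog I B A) (P : pred A) (f : A -> R) x :
  (forall a, P a -> x <= f a) -> pr t P <= expR (- x) * ex t (fun a => expR (f a)).
Proof.
move=> Pf; rewrite -exZ; apply: ex_le => a; rewrite -expRD.
case: (P a) (Pf a) => [/(_ isT) xf|_]; last exact: expR_ge0.
by apply: le_trans (expR_ge1Dx _); rewrite lerDl addrC subr_ge0.
Qed.

End Expectation.
Arguments traverse : simpl never.

(** * The variance-adaptive test *)

(** From [1 - u <= expR (- u)] comes [expR u * (1 - u) <= 1], while [(1 + u + 2 * u ^+ 2) * (1 - u)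
    = 1 + u ^+ 2 * (1 - 2 * u)] is at least 1. *)
Lemma expR_le_quadratic (R : realType) (u : R) :
  `|u| <= 2^-1 -> expR u <= 1 + u + 2 * u ^+ 2.
Proof.
rewrite ler_norml => /andP[u1 u2].
have h : 1 - u <= expR (- u) := expR_ge1Dx (- u).
have h1 : expR u * expR (- u) = 1 by rewrite expRN mulfV // gt_eqF // expR_gt0.
have h2 : expR u * (1 - u) <= 1.
  by rewrite -[leRHS]h1 ler_wpM2l // expR_ge0.
have h3 : 0 < 1 - u by lra.
rewrite -(ler_pM2r h3); apply: le_trans h2 _.
have h4 : 0 <= u ^+ 2 * (1 - 2 * u) by rewrite mulr_ge0 // ?sqr_ge0 //; lra.
nra.
Qed.

Section Test.
Variables (R : realType) (I B : finType) (y : B -> R).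
Hypothesis y01 : forall b, 0 <= y b <= 1.

Fixpoint pairs n i : prog I B (R * R) :=
  if n is n'.+1 then
    Draw i (fun b => Draw i (fun b' => bind (pairs n' i) (fun z =>
      Ret ((y b - y b') ^+ 2 + z.1, y b + y b' + z.2))))
  else Ret (0, 0).

(** Fixed by [8 * a ^+ 2 * threshold n e l = l] for the Chernoff slope [a = l / (n%:R * e)]. *)
Definition threshold (n : nat) (e l : R) := n%:R ^+ 2 * e ^+ 2 / (8 * l).

(* The squared differences estimate the variance; the test rejects when it
   looks too large for [n] pairs to locate the mean up to [e] with
   confidence [1 - expR (- l)]. *)
Definition test n e l i : prog I B (option R) :=
  bind (pairs n i) (fun z =>
    Ret (if z.1 <= threshold n e l then Some (z.2 / (2 * n%:R)) else None)).

Lemma pairs_cost n i : always (pairs n i) (fun m _ => m = 2 * n)%N.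
Proof.
elim: n => [//|n IH] /= b b'; apply: always_bind IH _ => m z /= ->.
by rewrite mulnS addn0.
Qed.

Lemma test_cost n e l i : always (test n e l i) (fun m _ => m = 2 * n)%N.
Proof. by apply: always_bind (pairs_cost n i) _ => m z /= ->; rewrite addn0. Qed.

Variable p : I -> B -> R.
Hypothesis p_ge0 : forall i b, 0 <= p i b.
Hypothesis p_sum1 : forall i, \sum_b p i b = 1.

Definition mean i := \sum_b p i b * y b.
Definition var i := \sum_b p i b * (y b - mean i) ^+ 2.

Lemma var_ge0 i : 0 <= var i.
Proof. by apply: sumr_ge0 => b _; rewrite mulr_ge0 ?sqr_ge0. Qed.

Lemma mean01 i : 0 <= mean i <= 1.
Proof.
apply/andP; split.
  by apply: sumr_ge0 => b _; rewrite mulr_ge0 //; case/andP: (y01 b).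
rewrite -(p_sum1 i); apply: ler_sum => b _; rewrite ler_piMr //.
by case/andP: (y01 b).
Qed.

Lemma sum_quadratic i a c d :
  \sum_b p i b * (a + c * (y b - mean i) + d * (y b - mean i) ^+ 2) =
  a + d * var i.
Proof.
have h : \sum_b p i b * (y b - mean i) = 0.
  under eq_bigr do rewrite mulrBr.
  by rewrite sumrB -mulr_suml p_sum1 mul1r subrr.
transitivity (a * \sum_b p i b + c * (\sum_b p i b * (y b - mean i)) + d * var i).
  rewrite /var !big_distrr /= -!big_split /=; apply: eq_bigr => b _; ring.
by rewrite p_sum1 h mulr1 mulr0 addr0.
Qed.

Lemma var_le1 i : var i <= 1.
Proof.
rewrite -(p_sum1 i); apply: ler_sum => b _; rewrite ler_piMr //.
have := y01 b; have := mean01 i => /andP[? ?] /andP[? ?]; nra.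
Qed.

(** The exponential is replaced by its quadratic bound, with [d ^+ 2 <= d] for the squared
    difference [d]; then only second moments remain, and [X + X' - 2 m] and [X - X'] both have
    second moment twice the variance. *)
Lemma pair_moment i a c : 2 * `|a| + `|c| <= 2^-1 ->
  \sum_b p i b * (\sum_b' p i b' *
    expR (a * (y b + y b' - 2 * mean i) - c * (y b - y b') ^+ 2))
  <= expR ((8 * a ^+ 2 + 8 * c ^+ 2 - 2 * c) * var i).
Proof.
move=> ac.
(* [k2] and [k3] are the coefficients of the squares and of the cross term in the two centred
   observations. *)
pose k2 := 4 * a ^+ 2 + 4 * c ^+ 2 - c.
pose k3 := 2 * (4 * a ^+ 2 - 4 * c ^+ 2 + c).
apply: (@le_trans _ _ (\sum_b p i b * (\sum_b' p i b' *
  ((1 + a * (y b - mean i) + k2 * (y b - mean i) ^+ 2) +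
   (a + k3 * (y b - mean i)) * (y b' - mean i) +
   k2 * (y b' - mean i) ^+ 2)))).
  apply: ler_sum => b _; rewrite ler_wpM2l //; apply: ler_sum => b' _.
  rewrite ler_wpM2l //.
  set u := (X in expR X <= _).
  have /andP[m0 m1] := mean01 i.
  have /andP[b0 b1] := y01 b; have /andP[b0' b1'] := y01 b'.
  set d := (y b - y b') ^+ 2 in u *.
  have d01 : 0 <= d <= 1 by rewrite sqr_ge0 /d /=; nra.
  set s := y b + y b' - 2 * mean i in u *.
  have s1 : `|s| <= 2 by rewrite ler_norml /s; apply/andP; split; lra.
  have u1 : `|u| <= 2^-1.
    apply: le_trans (ler_normB _ _) _; have /andP[d0 d1] := d01.
    rewrite (normrM a) (normrM c) (ger0_norm d0).
    apply: le_trans ac; apply: lerD; first by rewrite mulrC ler_wpM2r.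
    by rewrite ler_piMr.
  apply: le_trans (expR_le_quadratic u1) _.
  have h1 : d ^+ 2 <= d by case/andP: d01 => d0 d1; rewrite expr2 ler_piMr.
  have h2 : u ^+ 2 <= 2 * a ^+ 2 * s ^+ 2 + 2 * c ^+ 2 * d.
    have hc : c ^+ 2 * d ^+ 2 <= c ^+ 2 * d by rewrite ler_wpM2l ?sqr_ge0.
    have := sqr_ge0 (a * s + c * d); rewrite /u; nra.
  apply: (@le_trans _ _ (1 + u + 2 * (2 * a ^+ 2 * s ^+ 2 + 2 * c ^+ 2 * d))); first lra.
  rewrite /u /s /d /k2 /k3 le_eqVlt; apply/orP; left; apply/eqP; ring.
under eq_bigr do rewrite sum_quadratic.
rewrite (eq_bigr (fun b => p i b * (1 + k2 * var i + a * (y b - mean i) +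
  k2 * (y b - mean i) ^+ 2))); last by move=> b _; congr (_ * _); ring.
rewrite sum_quadratic; apply: le_trans (expR_ge1Dx _).
rewrite le_eqVlt /k2; apply/orP; left; apply/eqP; ring.
Qed.

Lemma pairs_moment n i a c : 2 * `|a| + `|c| <= 2^-1 ->
  ex p (pairs n i) (fun z => expR (a * (z.2 - 2 * n%:R * mean i) - c * z.1))
  <= expR (n%:R * ((8 * a ^+ 2 + 8 * c ^+ 2 - 2 * c) * var i)).
Proof.
move=> ac; elim: n => [|n IH] /=.
  by rewrite !mulr0 !mul0r subrr mulr0 subrr expR0.
rewrite [n.+1%:R * (_ * _)](_ : _ = (8 * a ^+ 2 + 8 * c ^+ 2 - 2 * c) * var i +
  n%:R * ((8 * a ^+ 2 + 8 * c ^+ 2 - 2 * c) * var i)); last first.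
  by rewrite -addn1 natrD; ring.
rewrite expRD.
apply: le_trans (ler_wpM2r (expR_ge0 _) (pair_moment i ac)).
apply: (@le_trans _ _ (\sum_b p i b * (\sum_b' p i b' *
    expR (a * (y b + y b' - 2 * mean i) - c * (y b - y b') ^+ 2) *
  expR (n%:R * ((8 * a ^+ 2 + 8 * c ^+ 2 - 2 * c) * var i))))).
  apply: ler_sum => b _; rewrite ler_wpM2l //; apply: ler_sum => b' _.
  rewrite -[leRHS]mulrA ler_wpM2l // ex_bind /=.
  apply: le_trans (ler_wpM2l (expR_ge0 _) IH).
  rewrite -exZ le_eqVlt; apply/orP; left; apply/eqP; apply: eq_ex => // z.
  rewrite -expRD -addn1 natrD; congr expR; ring.
rewrite big_distrl /= le_eqVlt; apply/orP; left; apply/eqP.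
by apply: eq_bigr => b _; rewrite -mulrA big_distrl.
Qed.

(** * Tail bounds for the test *)

Section TestTails.
Variables (n : nat) (e l : R) (i : I).
Hypotheses (e_gt0 : 0 < e) (l_gt0 : 0 < l) (n_large : 16 * l <= n%:R * e).

Let n_gt0 : 0 < n%:R :> R.
Proof. by rewrite -(pmulr_lgt0 _ e_gt0); apply: lt_le_trans n_large; rewrite mulr_gt0. Qed.

Lemma threshold_ge : 32 * l <= threshold n e l.
Proof.
rewrite /threshold ler_pdivlMr; last by rewrite mulr_gt0.
rewrite -exprMn; have := l_gt0; have := n_large; nra.
Qed.

Let tail_slope : R := l / (n%:R * e).

Let tail_slopeE : tail_slope * (n%:R * e) = l.
Proof. by rewrite /tail_slope divfK // gt_eqF // mulr_gt0. Qed.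

Let tail_slope01 : 0 <= tail_slope <= 16^-1.
Proof.
have ne : 0 < n%:R * e by rewrite mulr_gt0.
apply/andP; split; first by rewrite divr_ge0 // ltW.
rewrite ler_pdivrMr // -(ler_pM2l (_ : 0 < 16)) // mulrA mulfV // mul1r; exact: n_large.
Qed.

Let tail_slope_threshold : 8 * tail_slope ^+ 2 * threshold n e l = l.
Proof.
rewrite /tail_slope /threshold; field.
by rewrite !gt_eqF.
Qed.

(** The choice [c = 8 * a ^+ 2] turns the exponent of [pairs_moment] into [- 8 a^2 (1 - 64 a^2)]
    times [n] times the variance, nonpositive whatever the variance. On acceptance the penalty takes
    at most [l] of the [2 * l] gained by the deviation, so [l] is left. *)
Let deviation (a : R) (P : pred (R * R)) :
  a ^+ 2 = tail_slope ^+ 2 ->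
  (forall z, P z -> z.1 <= threshold n e l /\
    2 * l <= a * (z.2 - 2 * n%:R * mean i)) ->
  pr p (pairs n i) P <= expR (- l).
Proof.
move=> aE hP.
have a1 : `|a| = tail_slope.
  by rewrite -sqrtr_sqr aE sqrtr_sqr ger0_norm //; case/andP: tail_slope01.
have c1 : 2 * `|a| + `|8 * a ^+ 2| <= 2^-1.
  rewrite a1 aE ger0_norm; last by rewrite mulr_ge0 ?sqr_ge0.
  by case/andP: tail_slope01 => s0 s1; nra.
apply: le_trans (chernoff p_ge0 _ (f := fun z =>
  a * (z.2 - 2 * n%:R * mean i) - (8 * a ^+ 2) * z.1) (x := l) _) _.
  move=> z /hP[h1 h2].
  have h3 : (8 * a ^+ 2) * z.1 <= l.
    rewrite -[leRHS]tail_slope_threshold aE; apply: ler_wpM2l h1.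
    by rewrite mulr_ge0 ?sqr_ge0.
  lra.
rewrite -[leRHS]mulr1 ler_wpM2l ?expR_ge0 //.
apply: le_trans (pairs_moment n i c1) _.
rewrite -[leRHS]expR0 ler_expR mulr_ge0_le0 ?ler0n //.
rewrite mulr_le0_ge0 ?var_ge0 //.
have -> : 8 * a ^+ 2 + 8 * (8 * a ^+ 2) ^+ 2 - 2 * (8 * a ^+ 2) =
  - (8 * a ^+ 2 * (1 - 64 * a ^+ 2)) by ring.
rewrite oppr_le0; apply: mulr_ge0; first by rewrite mulr_ge0 ?sqr_ge0.
rewrite aE; by case/andP: tail_slope01 => s0 s1; nra.
Qed.

Let estimate_scale (z : R * R) :
  n%:R * (2 * (z.2 / (2 * n%:R))) = z.2.
Proof. by field; rewrite gt_eqF. Qed.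

Lemma test_overestimates :
  pr p (test n e l i) (fun o => if o is Some x then mean i + e < x else false)
  <= expR (- l).
Proof.
rewrite /pr ex_bind; apply: le_trans (deviation (a := tail_slope)
  (P := fun z => (z.1 <= threshold n e l) && (mean i + e < z.2 / (2 * n%:R))) erefl _).
  by apply: ex_le => // z /=; case: (_ <= threshold n e l).
move=> z /andP[? h]; split=> //; have /andP[s0 _] := tail_slope01.
rewrite -{1}tail_slopeE mulrCA ler_wpM2l //.
have := ler_wpM2l (ltW n_gt0) (ltW h); have := estimate_scale z; lra.
Qed.

Lemma test_underestimates :
  pr p (test n e l i) (fun o => if o is Some x then x < mean i - e else false)
  <= expR (- l).
Proof.
rewrite /pr ex_bind; apply: le_trans (deviation (a := - tail_slope)
  (P := fun z => (z.1 <= threshold n e l) && (z.2 / (2 * n%:R) < mean i - e))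
  (sqrrN _) _).
  by apply: ex_le => // z /=; case: (_ <= threshold n e l).
move=> z /andP[? h]; split=> //; have /andP[s0 _] := tail_slope01.
rewrite -{1}tail_slopeE mulrCA mulNr -mulrN ler_wpM2l //.
have := ler_wpM2l (ltW n_gt0) (ltW h); have := estimate_scale z; lra.
Qed.

Let threshold_small_var : 64 * var i * l <= n%:R * e ^+ 2 ->
  8 * (n%:R * var i) <= threshold n e l.
Proof.
move=> h; rewrite /threshold ler_pdivlMr; last by rewrite mulr_gt0.
have := ler_wpM2l (ltW n_gt0) h; nra.
Qed.

(** The squared differences sum to [2 * n * var] on average, but the threshold is at least
    [8 * n * var]. Slope [1/4] gives the exponent [n * var - threshold / 4 <= - threshold / 8], and
    the threshold is at least [32 * l]. *)
Lemma test_rejects : 64 * var i * l <= n%:R * e ^+ 2 ->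
  pr p (test n e l i) (fun o => o == None) <= expR (- (4 * l)).
Proof.
move=> /threshold_small_var h; rewrite /pr ex_bind.
apply: (@le_trans _ _ (pr p (pairs n i) (fun z => threshold n e l < z.1))).
  by apply: ex_le => // z /=; case: (ltP (threshold n e l)).
apply: le_trans (chernoff p_ge0 _ (f := fun z =>
  0 * (z.2 - 2 * n%:R * mean i) - (- 4^-1) * z.1) (x := 4^-1 * threshold n e l) _) _.
  by move=> z /ltW; lra.
apply: le_trans (ler_wpM2l (expR_ge0 _) (pairs_moment n i _)) _.
  rewrite normr0 normrN ger0_norm //. lra.
rewrite -expRD ler_expR.
have := threshold_ge; lra.
Qed.

(** Here the threshold is at most [n * var / 2], a quarter of the average of the sum; slope [1/8]
    again leaves the exponent [- threshold / 8]. *)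
Lemma test_accepts : 16 * (n%:R * e ^+ 2) < 64 * var i * l ->
  pr p (test n e l i) (fun o => o != None) <= expR (- (4 * l)).
Proof.
move=> h.
have {}h : 2 * threshold n e l <= n%:R * var i.
  rewrite mulrA ler_pdivrMr; last by rewrite mulr_gt0.
  have := ler_wpM2l (ltW n_gt0) (ltW h); nra.
rewrite /pr ex_bind.
apply: (@le_trans _ _ (pr p (pairs n i) (fun z => z.1 <= threshold n e l))).
  by apply: ex_le => // z /=; case: (z.1 <= threshold n e l).
apply: le_trans (chernoff p_ge0 _ (f := fun z =>
  0 * (z.2 - 2 * n%:R * mean i) - 8^-1 * z.1) (x := - (8^-1 * threshold n e l)) _) _.
  by move=> z; lra.
apply: le_trans (ler_wpM2l (expR_ge0 _) (pairs_moment n i _)) _.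
  by rewrite normr0 ger0_norm //; lra.
rewrite -expRD ler_expR.
have := threshold_ge; lra.
Qed.

End TestTails.
End Test.

(** * Median elimination with tests *)

Lemma sum_key_le (R : realType) (I : eqType) (s : seq I) (b : I) (f : I -> R) c :
  uniq s -> b \in s -> (forall i, i != b -> f i <= 0) -> f b <= c ->
  \sum_(i <- s) f i <= c.
Proof.
move=> us bs fi fb; rewrite (bigD1_seq b) //= -[c]addr0 lerD //.
by apply: sumr_le0 => i; apply: fi.
Qed.

Lemma expRN_le_half (R : realType) (l : R) : 1 <= l -> expR (- l) <= 2^-1.
Proof.
move=> l1; rewrite expRN lef_pV2 ?posrE ?expR_gt0 //.
apply: le_trans (expR_ge1Dx l); lra.
Qed.

(** * Selecting the highest accepted estimates *)

Section Top.
Variables (R : realType) (I : eqType).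
Implicit Types (l : seq (I * R)) (z : I * R).

Definition by_estimate : rel (I * R) := fun z z' => z'.2 <= z.2.

Definition top k l := take k (sort by_estimate l).

Lemma mem_top k l z : z \in top k l -> z \in l.
Proof. by move/mem_take; rewrite mem_sort. Qed.

Lemma size_top k l : (size (top k l) <= k)%N.
Proof. by rewrite size_take_min geq_minl. Qed.

Lemma top_uniq k l : uniq (unzip1 l) -> uniq (unzip1 (top k l)).
Proof.
move=> ul; rewrite /unzip1 map_take; apply: take_uniq.
by rewrite (perm_uniq (perm_map _ (permEl (perm_sort _ _)))).
Qed.

Lemma count_top P k l : (count P (top k l) <= count P l)%N.
Proof.
rewrite -(permP (permEl (perm_sort by_estimate l)) P).
by rewrite -[X in (_ <= count P X)%N](cat_take_drop k) count_cat leq_addr.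
Qed.

Lemma not_mem_top k l z : z \in l -> z \notin top k l ->
  size (top k l) = k /\ forall z', z' \in top k l -> z.2 <= z'.2.
Proof.
rewrite -(mem_sort by_estimate) -{1}(cat_take_drop k (sort _ l)) mem_cat -/(top k l).
move=> /orP[->//|zd] _; split.
  rewrite size_takel //; apply: ltnW; rewrite ltnNge; apply/negP => /drop_oversize h.
  by rewrite h in zd.
have tr : transitive by_estimate by move=> x y w xy yw; exact: le_trans yw xy.
have tot : total by_estimate by move=> x y; exact: le_total.
have := sort_sorted tot l; rewrite -{1}(cat_take_drop k (sort _ l)).
rewrite (sorted_pairwise tr) pairwise_cat => /andP[/allrelP h _] z' z't.
exact: h z't zd.
Qed.

Definition accepted (r : seq (I * option R)) : seq (I * R) :=
  pmap (fun u => omap (pair u.1) u.2) r.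

Lemma mem_accepted r i x : ((i, x) \in accepted r) = ((i, Some x) \in r).
Proof.
elim: r => [//|[j [w|]] r IH]; rewrite /accepted /= !inE -/(accepted r) IH //.
all: by rewrite !xpair_eqE ?andbF.
Qed.

Lemma accepted_uniq r : uniq (unzip1 r) -> uniq (unzip1 (accepted r)).
Proof.
apply: subseq_uniq; elim: r => [//|[j [w|]] r IH] /=; first by rewrite eqxx.
exact: subseq_trans IH (subseq_cons _ _).
Qed.

Lemma count_accepted P r :
  count P (accepted r) = count (fun u => if u.2 is Some x then P (u.1, x) else false) r.
Proof. by elim: r => [//|[j [w|]] r IH] /=; rewrite IH. Qed.

End Top.

Section Elimination.
Variables (R : realType) (I B : finType) (y : B -> R).
Hypothesis y01 : forall b, 0 <= y b <= 1.

Definition survivors (s : seq I) (r : seq (I * option R)) : seq I :=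
  unzip1 (top ((size s).-1 %/ 256).+1 (accepted r)).

(** The factor 128 is [4 * 2 * 16]: halving [e] costs 4, doubling [l] costs 2, and 16 pays for the
    larger variance a surviving arm may have. As long as [fuel] is at least the length of [s], it
    does not run out before a single arm is left. *)
Fixpoint elimination fuel n e l (s : seq I) : prog I B (option (I * R)) :=
  match fuel, s with
  | _, [::] => Ret None
  | fuel'.+1, _ :: _ :: _ =>
      bind (traverse (test y n e l) s) (fun r =>
        elimination fuel' (128 * n) (e / 2) (2 * l) (survivors s r))
  | _, i :: _ => bind (test y n e l i) (fun o => Ret (omap (pair i) o))
  end.

Lemma size_survivors s r : (size (survivors s r) <= ((size s).-1 %/ 256).+1)%N.
Proof. by rewrite size_map size_top. Qed.

Lemma survivors_uniq s r : uniq (unzip1 r) -> uniq (survivors s r).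
Proof. by move=> ur; apply/top_uniq/accepted_uniq. Qed.

(** [(size s).-1] falls by a factor 256 per round while the batch grows only by 128, so the costs of
    the rounds form a geometric series. *)
Lemma elimination_cost fuel n e l s :
  always (elimination fuel n e l s)
    (fun m _ => m <= n * (520 * (size s).-1 + 2))%N.
Proof.
have single n' e' l' (i : I) c : (2 * n' <= c)%N ->
    always (bind (test y n' e' l' i) (fun o => Ret (omap (pair i) o)))
      (fun m _ => m <= c)%N.
  by move=> nc; apply: always_bind (test_cost _ _ _ _ _) _ => m o /= ->; rewrite addn0.
elim: fuel n e l s => [|fuel IH] n e l [|i [|j s]] //=; try by apply: single; lia.
set s' := i :: j :: s.
have tc (x : I) : always (test y n e l x) (fun m _ => m <= 2 * n)%N.
  by apply: always_impl (test_cost y n e l x) => m o ->.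
have := always_and (traverse_cost (c := fun _ _ => (2 * n)%N) s' tc)
  (traverse_keys (test y n e l) s').
move/always_bind; apply => m r [mr kr].
apply: always_impl (IH _ _ _ _) => m' _.
have -> : (size s).+1 = (size s').-1 by [].
have /(leq_trans mr) {}mr : (\sum_(z <- r) 2 * n <= size s' * (2 * n))%N.
  by rewrite -kr size_map big_const_seq count_predT iter_addn_0 mulnC.
have hs := size_survivors s' r.
set M := (size s').-1 in hs *.
have sM : size s' = M.+1 by [].
have M1 : (1 <= M)%N by [].
have hd : (256 * (M %/ 256) <= M)%N by rewrite mulnC leq_divM.
have hs1 : ((size (survivors s' r)).-1 <= M %/ 256)%N by lia.
move=> hm'; rewrite sM in mr.
have h1 : (m' <= n * (128 * (520 * (M %/ 256) + 2)))%N.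
  by apply: (leq_trans hm'); rewrite -mulnA mulnCA leq_mul2l; lia.
have h2 : (n * (2 * M.+1 + 128 * (520 * (M %/ 256) + 2)) <= n * (520 * M + 2))%N.
  rewrite leq_mul2l; apply/orP; right; lia.
move: h1 h2 mr; rewrite mulnDr mulnCA => h1 h2 mr; lia.
Qed.

Variable p : I -> B -> R.
Hypothesis p_ge0 : forall i b, 0 <= p i b.
Hypothesis p_sum1 : forall i, \sum_b p i b = 1.
Local Notation mean := (mean y p).
Local Notation var := (var y p).

Lemma test_unsound n e l i : 0 < e -> 0 < l -> 16 * l <= n%:R * e ->
  pr p (bind (test y n e l i) (fun o => Ret (omap (pair i) o)))
    (fun o => if o is Some z then mean z.1 + e < z.2 else false) <= expR (- l).
Proof.
move=> e0 l0 nl; apply: le_trans (test_overestimates y01 p_ge0 p_sum1 i e0 l0 nl).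
by rewrite /pr ex_bind; apply: ex_le => // -[].
Qed.

Lemma test_misses n e l i : 0 < e -> 0 < l -> 16 * l <= n%:R * e ->
  64 * var i * l <= n%:R * e ^+ 2 ->
  pr p (test y n e l i) (fun o => if o is Some x then x < mean i - e else true)
  <= 2 * expR (- l).
Proof.
move=> e0 l0 nl vi.
apply: le_trans (pr_union p_ge0 (P1 := fun o => o == None)
  (P2 := fun o => if o is Some x then x < mean i - e else false) _ _) _.
  by case.
have h1 := test_rejects y01 p_ge0 p_sum1 e0 l0 nl vi.
have h2 := test_underestimates y01 p_ge0 p_sum1 i e0 l0 nl.
have h3 : expR (- (4 * l)) <= expR (- l) by rewrite ler_expR; lra.
lra.
Qed.

(** The returned estimate comes from one last test on fresh draws, whose overestimation bound holds
    for any arm; hence no union over rounds or arms. Later rounds only use a smaller [e] and a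
    larger [l]. *)
Lemma elimination_sound fuel n e l s : 0 < e -> 0 < l -> 16 * l <= n%:R * e ->
  pr p (elimination fuel n e l s)
    (fun o => if o is Some z then mean z.1 + e < z.2 else false) <= expR (- l).
Proof.
elim: fuel n e l s => [|fuel IH] n e l [|i [|j s]] e0 l0 nl /=;
  try exact: test_unsound; try by rewrite /pr /= expR_ge0.
apply: pr_bind_le_cst => // r.
have nl' : 16 * (2 * l) <= (128 * n)%:R * (e / 2) by rewrite natrM; nra.
apply: (@le_trans _ _ (expR (- (2 * l)))); last by rewrite ler_expR; lra.
apply: le_trans (IH _ _ _ _ _ _ nl'); try lra.
by apply: pr_le => // -[z|] //; lra.
Qed.

Section Round.
Variables (n : nat) (e l : R) (s : seq I) (b : I).
Hypotheses (e_gt0 : 0 < e) (l_gt0 : 0 < l) (n_large : 16 * l <= n%:R * e).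
Hypotheses (s_uniq : uniq s) (bs : b \in s).
Hypothesis b_admissible : 64 * var b * l <= n%:R * e ^+ 2.

(* An arm whose variance is slightly too large for this round may survive by
   luck, so the variance allowed in the next round is 16 times larger. *)
Let sound_witness i :=
  (64 * var i * l <= 16 * (n%:R * e ^+ 2)) && (mean b - 2 * e <= mean i).

Let misses (z : I * option R) :=
  (z.1 == b) && (if z.2 is Some x then x < mean b - e else true).

Let fooled (z : I * option R) :=
  if z.2 is Some x
  then (16 * (n%:R * e ^+ 2) < 64 * var z.1 * l) || (mean z.1 + e < x)
  else false.

Let kept := ((size s).-1 %/ 256).+1.

Let fooled_le i : pr p (test y n e l i) (fun o => fooled (i, o)) <= expR (- l).
Proof.
case: (ltP (16 * (n%:R * e ^+ 2)) (64 * var i * l)) => h.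
  have h3 : expR (- (4 * l)) <= expR (- l) by rewrite ler_expR; have := l_gt0; lra.
  apply: le_trans h3.
  apply: le_trans (test_accepts y01 p_ge0 p_sum1 e_gt0 l_gt0 n_large h).
  by apply: pr_le => // -[].
apply: le_trans (test_overestimates y01 p_ge0 p_sum1 i e_gt0 l_gt0 n_large).
by apply: pr_le => // -[x|] //; rewrite /fooled /= => /orP[|//]; rewrite ltNge h.
Qed.

(** If [b] is accepted with a good estimate but not kept, all [kept] places go to arms with
    estimates at least as high, and any of them that is not fooled is a witness. So failure needs a
    miss of [b] or at least [kept] fooled arms, which explains the weights 1 and [1 / kept]. *)
Let failure_count r : unzip1 r = s -> ~~ has sound_witness (survivors s r) ->
  1 <= \sum_(z <- r) ((misses z)%:R + kept%:R^-1 * (fooled z)%:R) :> R.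
Proof.
move=> kr; apply: contraR; rewrite -ltNge big_split /= -big_distrr /=.
have sumE (P : pred (I * option R)) : \sum_(z <- r) (P z)%:R = (count P r)%:R :> R.
  by rewrite -sum1_count natr_sum [RHS]big_mkcond /=; apply: eq_bigr => z _; case: (P z).
rewrite !sumE => small.
have k0 : 0 < kept%:R^-1 :> R by rewrite invr_gt0 ltr0n.
have nomiss : count misses r = 0%N.
  apply/eqP; rewrite -leqn0 -ltnS -(ltr_nat R); apply: le_lt_trans small.
  by rewrite lerDl mulr_ge0 // ltW.
have few : (count fooled r < kept)%N.
  rewrite -(ltr_nat R) -(mul1r kept%:R) -ltr_pdivrMr ?ltr0n // mulrC.
  by apply: le_lt_trans small; rewrite lerDr.
have /mapP[[b' o] zr /= bE] : b \in unzip1 r by rewrite kr.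
subst b'.
have /hasPn/(_ _ zr) : ~~ has misses r by rewrite has_count nomiss.
rewrite /misses /= eqxx /=; case: o zr => [x|//] zr; rewrite -leNgt => xb.
have v0 : 0 <= n%:R * e ^+ 2 by rewrite mulr_ge0 ?sqr_ge0.
have zacc : (b, x) \in accepted r by rewrite mem_accepted.
apply/hasP; case: (boolP ((b, x) \in top kept (accepted r))) => zt.
  exists b; first by apply/mapP; exists (b, x).
  rewrite /sound_witness; apply/andP; split; first by have := b_admissible; lra.
  by have := e_gt0; lra.
have [st ht] := not_mem_top zacc zt.
have : has (fun z => ~~ fooled (z.1, Some z.2)) (top kept (accepted r)).
  rewrite has_predC; apply: contraL few; rewrite all_count => /eqP ct.
  rewrite -leqNgt -st -ct; apply: leq_trans (count_top _ _ _) _.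
  by rewrite count_accepted; apply: sub_count => -[i [w|]].
case/hasP => -[i w] wt; rewrite /fooled /= negb_or -!leNgt => /andP[vi wi].
exists i; first by apply/mapP; exists (i, w).
by rewrite /sound_witness vi /=; have := ht _ wt; rewrite /=; lra.
Qed.

(** Missing [b] contributes 2; fooled arms contribute 256, since [size s <= 256 * kept]. *)
Lemma round_fails :
  pr p (traverse (test y n e l) s) (fun r => ~~ has sound_witness (survivors s r))
  <= 258 * expR (- l).
Proof.
apply: le_trans (pr_le_count p_ge0 p_sum1 _ (traverse_keys _ _) (fun _ => @failure_count)) _.
  by move=> z; rewrite addr_ge0 ?mulr_ge0 ?invr_ge0.
rewrite (eq_bigr (fun i => pr p (test y n e l i) (fun o => misses (i, o)) +
  kept%:R^-1 * pr p (test y n e l i) (fun o => fooled (i, o)))); last first.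
  by move=> i _; rewrite exD exZ.
rewrite big_split /= -big_distrr /=.
have hm : \sum_(i <- s) pr p (test y n e l i) (fun o => misses (i, o)) <= 2 * expR (- l).
  apply: (sum_key_le s_uniq bs).
    move=> i ib; rewrite -(ex_cst p_sum1 (test y n e l i) 0); apply: ex_le => // o.
    by rewrite /misses /= (negbTE ib).
  apply: le_trans (test_misses e_gt0 l_gt0 n_large b_admissible).
  by apply: pr_le => // o /andP[].
have hf : \sum_(i <- s) pr p (test y n e l i) (fun o => fooled (i, o)) <=
    (size s)%:R * expR (- l).
  rewrite mulr_natl -iter_addr_0 -(count_predT s) -big_const_seq; exact: ler_sum.
have hs : (size s)%:R <= 256 * kept%:R :> R.
  rewrite -natrM ler_nat /kept mulnS mulnC.
  have := divn_eq (size s).-1 256; have := ltn_pmod (size s).-1 (isT : (0 < 256)%N).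
  lia.
have k0 : 0 < kept%:R :> R by rewrite ltr0n.
have hf2 : kept%:R^-1 * (\sum_(i <- s) pr p (test y n e l i) (fun o => fooled (i, o)))
    <= 256 * expR (- l).
  rewrite ler_pdivrMl //; apply: le_trans hf _.
  by rewrite mulrA ler_wpM2r ?expR_ge0 // mulrC.
lra.
Qed.

End Round.

(** The reference arm changes from [b] to the witness that survives the round. The losses satisfy
    [2 e + 4 (e / 2) = 4 e], and since [expR (- l) <= 1/2] the failure bounds satisfy
    [258 + 520 / 2 <= 520]. *)
Lemma elimination_complete fuel n e l s b :
  uniq s -> (size s <= fuel)%N -> b \in s ->
  0 < e -> 1 <= l -> 16 * l <= n%:R * e -> 64 * var b * l <= n%:R * e ^+ 2 ->
  pr p (elimination fuel n e l s)
    (fun o => if o is Some z then z.2 < mean b - 4 * e else true)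
  <= 520 * expR (- l).
Proof.
elim: fuel n e l s b => [|fuel IH] n e l s b; first by case: s.
move=> us sf bs e0 l1 nl vb.
have l0 : 0 < l by lra.
have E0 := expR_ge0 (- l).
case: s us sf bs => [//|i [|j s]] us sf bs /=.
  move: bs; rewrite inE => /eqP bi; subst i.
  apply: (@le_trans _ _ (2 * expR (- l))); last lra.
  apply: le_trans (test_misses e0 l0 nl vb).
  rewrite /pr ex_bind; apply: ex_le => // -[x|] //=.
  rewrite ler_nat; case: (ltP x (mean b - 4 * e)) => // xs.
  by rewrite (_ : x < mean b - e) //; lra.
set s' := i :: j :: s in us sf bs *.
have h1 := expRN_le_half l1.
apply: (@le_trans _ _ (258 * expR (- l) + 520 * expR (- (2 * l)))); last first.
  have -> : expR (- (2 * l)) = expR (- l) * expR (- l).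
    by rewrite -expRD; congr expR; ring.
  have := ler_wpM2l E0 h1; lra.
have := round_fails e0 l0 nl us bs vb; set P := (X in pr _ _ X) => hr.
apply: le_trans (lerD hr (lexx _)).
apply: (pr_bind_le_always p_ge0 p_sum1 _ (traverse_keys _ _)).
  by rewrite mulr_ge0 ?ler0n ?expR_ge0.
move=> _ r kr; rewrite negbK => /hasP[i' i's /andP[vi' mi']].
apply: le_trans (IH _ _ _ _ i' _ _ i's _ _ _ _).
- by apply: pr_le => // -[z|] //; lra.
- by apply: survivors_uniq; rewrite kr.
- apply: leq_trans (size_survivors _ _) _.
  apply: leq_trans (_ : (size s').-1 <= fuel)%N; last exact: sf.
  exact: ltn_Pdiv.
- by rewrite divr_gt0.
- lra.
- by rewrite natrM; nra.
- rewrite natrM expr_div_n; lra.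
Qed.

End Elimination.

(** * Classification of the arms by variance *)

Lemma sum_ge_mem (R : realType) (T : eqType) (r : seq T) (g : T -> R) z :
  z \in r -> (forall x, 0 <= g x) -> g z <= \sum_(x <- r) g x.
Proof. by move=> zr g0; rewrite (big_rem z) //= lerDl sumr_ge0. Qed.

Section Classification.
Variables (R : realType) (I B : finType) (y : B -> R).
Hypothesis y01 : forall b, 0 <= y b <= 1.
Variables (n : nat) (e l : R).

Definition batch (j : nat) : nat := (2 ^ j * n)%N.

Fixpoint classify fuel j i : prog I B nat :=
  if fuel is fuel'.+1 then
    bind (test y (batch j) e l i) (fun o =>
      if o is Some _ then Ret j else classify fuel' j.+1 i)
  else Ret j.

(** Tests of doubling size telescope: those from level [j] to [J] cost exactly
    [4 * batch J - 2 * batch j]. *)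
Lemma classify_cost fuel j i :
  always (classify fuel j i) (fun m J => m + 2 * batch j <= 4 * batch J)%N.
Proof.
elim: fuel j => [|fuel IH] j /=; first lia.
apply: always_bind (test_cost _ _ _ _ _) _ => m [x|] -> /=; first lia.
by apply: always_impl (IH j.+1) => m' J; rewrite /batch expnS; lia.
Qed.

Lemma classify_ge fuel j i : always (classify fuel j i) (fun _ J => j <= J)%N.
Proof.
elim: fuel j => [|fuel IH] j //=.
apply: always_bind (test_cost _ _ _ _ _) _ => m [x|] _ //=.
by apply: always_impl (IH j.+1) => _ J /ltnW.
Qed.

Variable p : I -> B -> R.
Hypothesis p_ge0 : forall i b, 0 <= p i b.
Hypothesis p_sum1 : forall i, \sum_b p i b = 1.
Local Notation mean := (mean y p).
Local Notation var := (var y p).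

Hypotheses (e_gt0 : 0 < e) (l_ge1 : 1 <= l) (n_large : 16 * l <= n%:R * e).

Let l_gt0 : 0 < l.
Proof. by apply: lt_le_trans l_ge1. Qed.

Lemma batch_large j : 16 * l <= (batch j)%:R * e.
Proof.
apply: le_trans n_large _; rewrite ler_pM2r // ler_nat /batch.
by rewrite leq_pmull // expn_gt0.
Qed.

Definition too_small i j := 16 * ((batch j)%:R * e ^+ 2) < 64 * var i * l.

(** Stopping too early requires one of at most [fuel] tests to accept at a level that is too small;
    exhausting the fuel ends at a level that is not. *)
Lemma classify_too_small fuel j i : ~~ too_small i (j + fuel) ->
  pr p (classify fuel j i) (fun J => too_small i J || (j + fuel < J)%N)
  <= fuel%:R * expR (- l).
Proof.
elim: fuel j => [|fuel IH] j; rewrite ?addn0 => hj.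
  by rewrite /pr /= mul0r (negbTE hj) ltnn.
have hl : expR (- (4 * l)) <= expR (- l) by rewrite ler_expR; have := l_gt0; lra.
apply: (@le_trans _ _ (expR (- l) + fuel%:R * expR (- l))); last first.
  by rewrite -natr1 mulrDl mul1r addrC.
apply: (@le_trans _ _ (pr p (test y (batch j) e l i)
  (fun o => (o != None) && too_small i j) + fuel%:R * expR (- l))).
  have fE : 0 <= fuel%:R * expR (- l) by rewrite mulr_ge0 ?expR_ge0.
  apply: pr_bind_le => //.
  move=> [x|]; rewrite /= -?ltnNge => h.
    rewrite /pr /= (negbTE h) /= ltnNge leq_addr /=.
    exact: fE.
  by rewrite -addSnnS; apply: IH; rewrite addSnnS.
rewrite lerD2r; case: (boolP (too_small i j)) => h.
  apply: le_trans hl.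
  apply: le_trans (test_accepts y01 p_ge0 p_sum1 e_gt0 l_gt0 (batch_large j) h).
  by apply: pr_le => // o /andP[].
apply: (@le_trans _ _ 0); last exact: expR_ge0.
rewrite -[leRHS](ex_cst p_sum1 (test y (batch j) e l i)).
by apply: ex_le => // o; rewrite andbF.
Qed.

(** From an adequate level on, each further step doubles the batch but is taken with probability at
    most [expR (- l) / 4], so the expected batch is a convergent geometric sum. *)
Lemma classify_power fuel j i : 64 * var i * l <= (batch j)%:R * e ^+ 2 ->
  ex p (classify fuel j i) (fun J => (2 ^ J)%:R)
  <= (2 ^ j)%:R * (1 + expR (- l)).
Proof.
have E0 := expR_ge0 (- l); have E1 := expRN_le_half l_ge1.
elim: fuel j => [|fuel IH] j hj /=.
  by rewrite ler_peMr ?lerDl.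
rewrite ex_bind.
set c := (2 ^ j.+1)%:R * (1 + expR (- l)).
have hj' : 64 * var i * l <= (batch j.+1)%:R * e ^+ 2.
  apply: le_trans hj _; rewrite ler_wpM2r ?sqr_ge0 // ler_nat /batch expnS.
  by rewrite -mulnA leq_pmull.
apply: (@le_trans _ _ (ex p (test y (batch j) e l i)
  (fun o => (2 ^ j)%:R + c * (o == None)%:R))).
  apply: ex_le => // -[x|] /=; first by rewrite mulr0 addr0.
  by rewrite mulr1; apply: le_trans (IH _ hj') _; rewrite lerDr.
rewrite exD exZ ex_cst // mulrDr mulr1 lerD2l.
have h : ex p (test y (batch j) e l i) (fun o => (o == None)%:R) <= expR (- l) / 4.
  apply: le_trans (test_rejects y01 p_ge0 p_sum1 e_gt0 l_gt0 (batch_large j) hj) _.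
  have -> : - (4 * l) = - l + - l + - l + - l by ring.
  rewrite !expRD -!mulrA ler_wpM2l //.
  apply: (@le_trans _ _ (2^-1 * (2^-1 * 1))); last lra.
  rewrite ler_pM ?mulr_ge0 // ler_pM //.
  lra.
have c0 : 0 <= c by rewrite mulr_ge0 ?addr_ge0.
apply: le_trans (ler_wpM2l c0 h) _.
have -> : c * (expR (- l) / 4) = (2 ^ j)%:R * ((1 + expR (- l)) * expR (- l) / 2).
  by rewrite /c expnS natrM; field.
rewrite ler_wpM2l //.
have := ler_wpM2l E0 E1; lra.
Qed.

(** The subtraction is truncated, so a run that stops before level [k] contributes 0; one that
    reaches [k] is governed by [classify_power]. *)
Lemma classify_excess fuel j k i : (j <= k)%N ->
  64 * var i * l <= (batch k)%:R * e ^+ 2 ->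
  ex p (classify fuel j i) (fun J => (2 ^ J - 2 ^ k)%:R)
  <= (2 ^ k)%:R * expR (- l).
Proof.
move=> jk hk; have E0 := expR_ge0 (- l).
elim: fuel j jk => [|fuel IH] j jk.
  rewrite /= (_ : 2 ^ j - 2 ^ k = 0)%N ?mulr_ge0 //.
  by apply/eqP; rewrite subn_eq0 leq_exp2l.
move: jk; rewrite leq_eqVlt => /orP[/eqP ->|jk].
  have := classify_power fuel.+1 hk; rewrite mulrDr mulr1 -lerBlDl.
  apply: le_trans; rewrite -[X in _ - X](ex_cst p_sum1 (classify fuel.+1 k i)).
  rewrite -mulN1r -exZ -exD.
  apply: (ex_le_always p_ge0 (classify_ge fuel.+1 k i)) => m J kJ.
  by rewrite natrB ?mulN1r // leq_exp2l.
rewrite /= ex_bind -[leRHS](ex_cst p_sum1 (test y (batch j) e l i)).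
apply: ex_le => // -[x|] /=; last exact: IH.
rewrite (_ : 2 ^ j - 2 ^ k = 0)%N ?mulr_ge0 //.
by apply/eqP; rewrite subn_eq0 leq_exp2l // ltnW.
Qed.

(** Take the least adequate level: either it is 0, with batch [n], or its predecessor is inadequate
    and the batch is at most twice the required size. *)
Lemma exists_level i : exists j,
  64 * var i * l <= (batch j)%:R * e ^+ 2 /\
  (batch j)%:R <= n%:R + 128 * var i * l / e ^+ 2.
Proof.
have e20 : 0 < e ^+ 2 by rewrite exprn_gt0.
have n0 : 0 < n%:R :> R.
  by rewrite -(pmulr_lgt0 _ e_gt0); apply: lt_le_trans n_large; rewrite mulr_gt0.
pose P j := 64 * var i * l <= (batch j)%:R * e ^+ 2.
have exP : exists j, P j.
  pose x := 64 * var i * l / e ^+ 2 / n%:R.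
  exists (Num.truncn x).+1; rewrite /P -ler_pdivrMr // /batch natrM -ler_pdivrMr //.
  apply: ltW; apply: lt_le_trans (truncnS_gt _) _; rewrite ler_nat ltnW //.
  exact: ltn_expl.
case: (ex_minnP exP) => -[|j] Pj jmin.
  exists 0%N; split=> //; rewrite /batch mul1n lerDl.
  by rewrite divr_ge0 ?(ltW e20) // !mulr_ge0 ?var_ge0 // ltW.
exists j.+1; split=> //.
have : ~~ P j by apply/negP => /jmin; rewrite ltnn.
rewrite -ltNge => h; apply: ler_wpDl; first exact: ltW.
rewrite ler_pdivlMr // /batch expnS -mulnA natrM -/(batch j).
by have := ltW h; lra.
Qed.

End Classification.

(** * The full algorithm *)

Section Solve.
Variables (R : realType) (I B : finType) (y : B -> R).
Hypothesis y01 : forall b, 0 <= y b <= 1.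
Variables (n : nat) (e l : R) (L : nat) (i0 : I).

Definition levels : seq nat := iota 0 L.+1.

Definition level (r : seq (I * nat)) j : seq I := [seq z.1 | z <- r & z.2 == j].

(** The factor 16 absorbs the margin in [too_small]: an arm not classified too low is then
    admissible for the elimination. *)
Definition level_elimination r j : prog I B (option (I * R)) :=
  elimination y #|I| (16 * batch n j) e l (level r j).

Definition choose (w : seq (nat * option (I * R))) : I :=
  (head (i0, 0) (top 1 (pmap snd w))).1.

Definition weight (r : seq (I * nat)) : nat := \sum_(z <- r) 2 ^ z.2.

(** The weight accompanies the answer so that the number of draws is bounded by the output of each
    run; it is dropped from the final policy. *)
Definition solve : prog I B (I * nat) :=
  bind (traverse (classify y n e l L 0) (enum I)) (fun r =>
    bind (traverse (level_elimination r) (levels)) (fun w =>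
      Ret (choose w, weight r))).

Lemma levels_uniq : uniq levels.
Proof. exact: iota_uniq. Qed.

Lemma level_elimination_cost r j :
  always (level_elimination r j)
    (fun m _ => m <= 16 * 522 * n * (2 ^ j * size (level r j)))%N.
Proof.
rewrite /level_elimination; case: (level r j) => [|i s] /=.
  by case: #|I| => [|k] /=; rewrite muln0.
apply: always_impl (elimination_cost _ _ _ _ _ _) => m _ /=.
move/leq_trans; apply; rewrite /batch.
have -> : (16 * 522 * n * (2 ^ j * (size s).+1) = 16 * (2 ^ j * n) * (522 * (size s).+1))%N by lia.
rewrite leq_mul2l; apply/orP; right; lia.
Qed.

Lemma sum_levels (r : seq (I * nat)) :
  (\sum_(j <- levels) 2 ^ j * size (level r j) <= weight r)%N.
Proof.
rewrite /weight (eq_bigr (fun j => \sum_(z <- r) 2 ^ j * (z.2 == j)))%N; last first.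
  move=> j _; rewrite size_map size_filter -big_distrr /= -sum1_count.
  by rewrite big_mkcond.
rewrite exchange_big /=; apply: leq_sum => z _.
case: (boolP (z.2 \in levels)) => zi; last first.
  rewrite big1_seq // => j /andP[_ ji]; case: eqP => [zj|]; last by rewrite muln0.
  by move: zi; rewrite zj ji.
rewrite (bigD1_seq z.2 zi levels_uniq) /= eqxx muln1 big1 ?addn0 // => j.
by rewrite eq_sym => /negbTE ->; rewrite muln0.
Qed.

Lemma solve_cost : always solve (fun m a => m <= (4 + 16 * 522) * n * a.2)%N.
Proof.
apply: always_bind (traverse_cost (c := fun _ J => (4 * n * 2 ^ J)%N) _ _) _.
  move=> i; apply: always_impl (classify_cost y n e l L 0 i) => m J.
  rewrite /batch; lia.
move=> m r; rewrite -big_distrr /= -/(weight r) => mr.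
apply: always_bind (always_and (traverse_keys _ _) (traverse_cost _
  (c := fun j _ => (16 * 522 * n * (2 ^ j * size (level r j)))%N) _)) _.
  by move=> j; apply: level_elimination_cost.
move=> m' w [kw mw] /=; rewrite addn0.
have {}mw : (m' <= 16 * 522 * n * weight r)%N.
  apply: leq_trans mw _; rewrite -big_distrr /= leq_mul2l.
  apply/orP; right; apply: leq_trans (sum_levels r).
  by rewrite -kw big_map.
have := leq_add mr mw; lia.
Qed.

Variable p : I -> B -> R.
Hypothesis p_ge0 : forall i b, 0 <= p i b.
Hypothesis p_sum1 : forall i, \sum_b p i b = 1.
Local Notation mean := (mean y p).
Local Notation var := (var y p).

Hypotheses (e_gt0 : 0 < e) (l_ge1 : 1 <= l) (n_large : 16 * l <= n%:R * e).
Hypothesis L_large : 4 <= 2 ^+ L * e.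
Variables (b : I) (k : I -> nat).
Hypothesis k_large : forall i, 64 * var i * l <= (batch n (k i))%:R * e ^+ 2.

Let l_gt0 : 0 < l.
Proof. by apply: lt_le_trans l_ge1. Qed.

(** Variances are at most 1 and [2 ^+ L * e >= 4], so the last level is large enough for every
    arm. *)
Let L_fine i : ~~ too_small y n e l p i L.
Proof.
rewrite /too_small -leNgt /batch natrM natrX.
have vl : var i * l <= l by rewrite ler_piMl ?var_le1 // ltW.
have h1 := ler_wpM2l (ltW l_gt0) L_large.
have h2 : 0 <= 2 ^+ L * e by rewrite mulr_ge0 ?exprn_ge0 // ltW.
have h3 := ler_wpM2l h2 n_large.
have -> : 16 * (2 ^+ L * n%:R * e ^+ 2) = 16 * (2 ^+ L * e * (n%:R * e)) by ring.
by rewrite -mulrA; have := l_gt0; lra.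
Qed.

Let weight_bound : nat := \sum_(i <- enum I) 2 ^ k i.

Let weight_bound_gt0 : 0 < weight_bound%:R :> R.
Proof.
rewrite ltr0n /weight_bound (bigD1_seq b) ?enum_uniq ?mem_enum //=.
by rewrite ltn_addr // expn_gt0.
Qed.

Let unfit z := too_small y n e l p z.1 z.2 || (L < z.2)%N.

(** Only the best arm [b] has to be placed correctly. Other arms may be misplaced:
    [elimination_sound] holds for any variance, and the weight controls the cost. *)
Let classified (r : seq (I * nat)) :=
  has (fun z => (z.1 == b) && ~~ unfit z) r && (weight r <= 2 * weight_bound)%N.

(** Either [b] itself is unfit, or the weight exceeds [2 * weight_bound] and the total excess is at
    least [weight_bound]. *)
Let classification_failure_count r : unzip1 r = enum I -> ~~ classified r ->
  1 <= \sum_(z <- r) (((z.1 == b) && unfit z)%:R +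
    weight_bound%:R^-1 * (2 ^ z.2 - 2 ^ k z.1)%:R) :> R.
Proof.
move=> kr; rewrite negb_and => /orP[nb|nw].
  have /mapP[z zr zb] : b \in unzip1 r by rewrite kr mem_enum.
  move/hasPn/(_ _ zr) : nb; rewrite -zb eqxx negbK /= => uz.
  apply: le_trans (sum_ge_mem zr _).
    by rewrite -zb eqxx uz lerDl mulr_ge0 // invr_ge0.
  by move=> x; rewrite addr_ge0 // mulr_ge0 // invr_ge0.
rewrite big_split /= ler_wpDl ?sumr_ge0 // -big_distrr /=.
rewrite ler_pdivlMl // mulr1 -natr_sum ler_nat.
have wE : weight_bound = (\sum_(z <- r) 2 ^ k z.1)%N by rewrite /weight_bound -kr big_map.
have : (weight r <= \sum_(z <- r) (2 ^ z.2 - 2 ^ k z.1) + weight_bound)%N.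
  rewrite wE -big_split /=; apply: leq_sum => z _; lia.
by move: nw; rewrite -ltnNge; lia.
Qed.

Let classification_fails :
  pr p (traverse (classify y n e l L 0) (enum I)) (predC classified)
  <= (L%:R + 1) * expR (- l).
Proof.
apply: le_trans (pr_le_count p_ge0 p_sum1 _ (traverse_keys _ _)
  (fun _ => @classification_failure_count)) _.
  by move=> z; rewrite addr_ge0 ?mulr_ge0 ?invr_ge0.
rewrite (eq_bigr (fun i => pr p (classify y n e l L 0 i)
    (fun J => (i == b) && unfit (i, J)) + weight_bound%:R^-1 *
  ex p (classify y n e l L 0 i) (fun J => (2 ^ J - 2 ^ k i)%:R))); last first.
  by move=> i _; rewrite exD exZ.
rewrite big_split /= mulrDl mul1r -big_distrr /=; apply: lerD.
  apply: (sum_key_le (enum_uniq I) (mem_enum I b)).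
    move=> i ib; rewrite -(ex_cst p_sum1 (classify y n e l L 0 i) 0).
    by apply: ex_le => // J; rewrite (negbTE ib).
  have := classify_too_small (fuel := L) (j := 0) y01 p_ge0 p_sum1 e_gt0 l_ge1
    n_large (L_fine b).
  by apply: le_trans; apply: pr_le => // J /andP[].
rewrite ler_pdivrMl // /weight_bound natr_sum big_distrl /=.
apply: ler_sum => i _; exact: classify_excess.
Qed.

Let sound_choice i := mean b - 5 * e <= mean i.

(** Soundness is required at all [L + 1] levels, completeness (520) only at the level of [b]. That
    level offers an estimate of at least [mean b - 4 * e], so the highest estimate is no lower and
    exceeds the mean of its arm by at most [e]. *)
Let choice_fails r : unzip1 r = enum I -> classified r ->
  pr p (traverse (level_elimination r) (levels))
    (fun w => ~~ sound_choice (choose w))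
  <= (L%:R + 521) * expR (- l).
Proof.
move=> kr /andP[/hasP[[b' J] zr /= /andP[/eqP bb uz]] _]; subst b'.
move: uz; rewrite /unfit negb_or -leqNgt -leNgt /= => /andP[sJ JL].
have ur : uniq (level r J).
  have : uniq (unzip1 r) by rewrite kr enum_uniq.
  by apply: subseq_uniq; rewrite map_subseq // filter_subseq.
have bJ : b \in level r J by apply/mapP; exists (b, J) => //; rewrite mem_filter eqxx.
have sz : (size (level r J) <= #|I|)%N by rewrite -(card_uniqP ur) max_card.
have J_levels : J \in levels by rewrite mem_iota.
have n_large' j : 16 * l <= (16 * batch n j)%:R * e.
  apply: le_trans (batch_large e_gt0 n_large j) _; rewrite ler_pM2r // ler_nat.
  by rewrite leq_pmull.
pose unsound (o : option (I * R)) := if o is Some z then mean z.1 + e < z.2 else false.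
pose incomplete (o : option (I * R)) :=
  if o is Some z then z.2 < mean b - 4 * e else true.
have failure_count (w : seq (nat * option (I * R))) : unzip1 w = levels ->
    ~~ sound_choice (choose w) ->
    1 <= \sum_(z <- w) ((unsound z.2)%:R + ((z.1 == J) && incomplete z.2)%:R) :> R.
  move=> kw; apply: contraR; rewrite -ltNge => small.
  have ok z : z \in w -> ~~ (unsound z.2 || ((z.1 == J) && incomplete z.2)).
    move=> zw; apply: contraTN small; rewrite -leNgt => h.
    apply: le_trans (sum_ge_mem zw _); last by move=> x; rewrite addr_ge0.
    by rewrite -natrD ler1n; case/orP: h => ->; rewrite ?addn1.
  have /mapP[[J' o] zw /= JJ] : J \in unzip1 w by rewrite kw.
  subst J'; have := ok _ zw; rewrite eqxx /= negb_or => /andP[_].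
  case: o zw => [z|//] zw; rewrite /= -leNgt => zb.
  have zp : z \in pmap snd w by rewrite mem_pmap; apply/mapP; exists (J, Some z).
  have [z' [z'p zz' ->]] : exists z', [/\ z' \in pmap snd w, z.2 <= z'.2 & choose w = z'.1].
    rewrite /choose; case: (boolP (z \in top 1 (pmap snd w))) => zt.
      have := size_top 1 (pmap snd w).
      case: (top 1 _) zt => [//|z' [|//]]; rewrite inE => /eqP <- _.
      by exists z.
    have [+ +] := not_mem_top zp zt.
    case E : (top 1 _) => [//|z' s] _ /(_ z'); rewrite mem_head => /(_ isT) zz'.
    by exists z'; split=> //; apply: (@mem_top _ _ 1); rewrite E mem_head.
  move: z'p; rewrite mem_pmap => /mapP[[j o] jw /= oE]; subst o.
  have := ok _ jw; rewrite /= negb_or -leNgt => /andP[h _].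
  by rewrite /sound_choice; lra.
apply: le_trans (pr_le_count p_ge0 p_sum1 _ (traverse_keys _ _)
  (fun _ => @failure_count)) _; first by move=> z; rewrite addr_ge0.
rewrite (eq_bigr (fun j => pr p (level_elimination r j) unsound +
  pr p (level_elimination r j) (fun o => (j == J) && incomplete o))); last first.
  by move=> j _; rewrite exD.
rewrite big_split /= (_ : L%:R + 521 = L.+1%:R + 520); last by rewrite -natr1; ring.
rewrite mulrDl; apply: lerD.
  rewrite mulr_natl -[X in _ *+ X](size_iota 0 L.+1) -iter_addr_0 -(count_predT levels).
  rewrite -big_const_seq; apply: ler_sum => j _.
  exact: elimination_sound.
apply: (sum_key_le levels_uniq J_levels).
  move=> j jJ; rewrite -(ex_cst p_sum1 (level_elimination r j) 0).
  by apply: ex_le => // o; rewrite (negbTE jJ).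
apply: le_trans (elimination_complete y01 p_ge0 p_sum1 ur sz bJ e_gt0 l_ge1 (n_large' J) _).
  by apply: pr_le => // o /andP[].
by rewrite natrM -[leRHS]mulrA.
Qed.

Lemma solve_fails :
  pr p solve (fun a => ~~ ((mean b - 5 * e <= mean a.1) &&
    (a.2 <= 2 * \sum_(i <- enum I) 2 ^ k i)%N))
  <= (2 * L%:R + 522) * expR (- l).
Proof.
have -> : 2 * L%:R + 522 = (L%:R + 1) + (L%:R + 521) :> R by ring.
rewrite [leRHS]mulrDl; apply: le_trans (lerD classification_fails (lexx _)).
apply: (pr_bind_le_always p_ge0 p_sum1 _ (traverse_keys _ _)).
  by apply: mulr_ge0; [apply: addr_ge0; exact: ler0n | exact: expR_ge0].
move=> _ r kr ncr; have cr : classified r by move: ncr; rewrite /= negbK.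
apply: le_trans (choice_fails kr cr).
rewrite /pr ex_bind; apply: ex_le => // w /=.
by case/andP: cr => _ ->; rewrite andbT.
Qed.

End Solve.

(** * Rounding the observations *)

Section Quantization.
Variables (R : realType) (N : nat).
Hypothesis N_gt0 : (0 < N)%N.

Local Open Scope classical_set_scope.

Definition quantize (x : R) : 'I_N.+1 := inord (minn N (Num.truncn (N%:R * x))).

Definition grid (b : 'I_N.+1) : R := b%:R / N%:R.

Let N0 : 0 < N%:R :> R.
Proof. by rewrite ltr0n. Qed.

Lemma val_quantize x : quantize x = minn N (Num.truncn (N%:R * x)) :> nat.
Proof. by rewrite inordK // ltnS geq_minl. Qed.

Lemma grid01 b : 0 <= grid b <= 1.
Proof.
rewrite divr_ge0 //= ler_pdivrMr // mul1r ler_nat -ltnS; exact: ltn_ord.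
Qed.

Lemma grid_quantize x : 0 <= x <= 1 ->
  grid (quantize x) <= x <= grid (quantize x) + N%:R^-1.
Proof.
move=> /andP[x0 x1].
have nx : 0 <= N%:R * x by rewrite mulr_ge0.
have /andP[t0 t1] := truncn_itv nx.
have tN : (Num.truncn (N%:R * x) <= N)%N.
  rewrite -(ler_nat R); apply: le_trans t0 _; rewrite ler_piMr //.
have Ni : N%:R^-1 * N%:R = 1 :> R by rewrite mulVf // gt_eqF.
rewrite /grid val_quantize (minn_idPr tN) ler_pdivrMr // [x * _]mulrC t0 /=.
by rewrite -(ler_pM2r N0) mulrDl divfK ?gt_eqF // Ni [x * _]mulrC natr1 ltW.
Qed.

Lemma measurable_quantize_gt j : measurable [set x : R | (j < quantize x)%N].
Proof.
case: (ltnP j N) => jN; last first.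
  rewrite (_ : [set _ | _] = set0) //; apply/seteqP; split=> // x /=.
  by rewrite val_quantize ltn_min ltnNge jN.
rewrite (_ : [set _ | _] = `[j.+1%:R / N%:R, +oo[); first exact: measurable_itv.
apply/seteqP; split=> x /=; rewrite val_quantize ltn_min jN /= in_itv /= andbT;
  by rewrite truncn_gt_nat ler_pdivrMr // mulrC.
Qed.

Lemma measurable_quantize b : measurable (quantize @^-1` [set b]).
Proof.
case: b => -[|j] jN.
  rewrite (_ : _ @^-1` _ = ~` [set x | (0 < quantize x)%N]).
    by apply: measurableC; exact: measurable_quantize_gt.
  apply/seteqP; split=> x /=; first by move=> ->.
  by move/negP; rewrite lt0n negbK => /eqP h; apply: val_inj.
rewrite (_ : _ @^-1` _ = [set x | (j < quantize x)%N] `\` [set x | (j.+1 < quantize x)%N]).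
  by apply: measurableD; exact: measurable_quantize_gt.
apply/seteqP; split=> x /=; first by move=> -> /=; rewrite ltnn ltnSn.
move=> [h1 /negP]; rewrite -leqNgt => h2; apply: val_inj => /=.
by apply/eqP; rewrite eqn_leq h2.
Qed.

Definition pmf (mu : probability R R) (b : 'I_N.+1) : R :=
  fine (mu (quantize @^-1` [set b])).

Variable mu : probability R R.

Lemma pmf_ge0 b : 0 <= pmf mu b.
Proof. exact: fine_ge0. Qed.

Let pmfE b : (pmf mu b)%:E = mu (quantize @^-1` [set b]).
Proof.
rewrite fineK // fin_num_measure //; exact: measurable_quantize.
Qed.

Lemma quantizeE (F : 'I_N.+1 -> R) x :
  F (quantize x) = \sum_b F b * \1_(quantize @^-1` [set b]) x.
Proof.
rewrite (bigD1 (quantize x)) //= big1 ?addr0 ?indicE ?mem_set ?mulr1 // => b bx.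
rewrite indicE memNset ?mulr0 // => /= h; by rewrite -h eqxx in bx.
Qed.

Lemma integrable_quantize (F : 'I_N.+1 -> R) :
  mu.-integrable setT (fun x => (F (quantize x))%:E).
Proof.
rewrite (_ : (fun x => _) = fun x =>
  (\sum_b (F b * \1_(quantize @^-1` [set b]) x)%:E)%E); last first.
  by apply/funext => x; rewrite sumEFin -quantizeE.
apply: integrable_sum => // b _.
rewrite (_ : (fun x => _) = fun x =>
  ((F b)%:E * (\1_(quantize @^-1` [set b]) x)%:E)%E) //.
apply: integrableZl => //; apply: integrable_indic => //.
exact: measurable_quantize.
Qed.

Lemma integral_quantize (F : 'I_N.+1 -> R) :
  (\int[mu]_x (F (quantize x))%:E)%E = (\sum_b pmf mu b * F b)%:E.
Proof.
under eq_integral do rewrite quantizeE -sumEFin.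
have mi b : mu.-integrable setT (fun x => (\1_(quantize @^-1` [set b]) x)%:E).
  by apply: integrable_indic => //; exact: measurable_quantize.
rewrite integral_sum //; last first.
  move=> b; rewrite (_ : (fun x => _) = fun x =>
    ((F b)%:E * (\1_(quantize @^-1` [set b]) x)%:E)%E) //.
  exact: integrableZl.
rewrite -sumEFin; apply: eq_bigr => b _.
under eq_integral do rewrite EFinM.
rewrite integralZl // integral_indic ?setIT //; last exact: measurable_quantize.
by rewrite EFinM pmfE muleC.
Qed.

Lemma pmf_sum1 : \sum_b pmf mu b = 1.
Proof.
apply: EFin_inj; have := integral_quantize (fun=> 1).
under eq_bigr do rewrite mulr1.
rewrite integral_cst // mul1e => <-; exact: probability_setT.
Qed.

Hypothesis mu01 : supported01 mu.

Let D : set R := [set x | 0 <= x <= 1].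

Let mD : measurable D.
Proof.
rewrite (_ : D = `[0, 1]); first exact: measurable_itv.
by apply/seteqP; split=> x /=; rewrite in_itv.
Qed.

Let DC0 : mu (~` D) = 0%E.
Proof. by rewrite probability_setC // mu01 subee. Qed.

Let integralD_supp (f : R -> \bar R) : mu.-integrable setT f ->
  (\int[mu]_x f x = \int[mu]_(x in D) f x)%E.
Proof.
move=> fi; rewrite (negligible_integral (measurableC mD) _ fi DC0) //.
by rewrite setTD setCK.
Qed.

Lemma integrable_supported (G : R -> R) M : measurable_fun setT G ->
  (forall x, 0 <= x <= 1 -> `|G x| <= M) -> mu.-integrable setT (EFin \o G).
Proof.
move=> mG GM; rewrite (negligible_integrable (measurableC mD)) //; last exact/measurable_EFinP.
rewrite setTD setCK; apply: measurable_bounded_integrable => //.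
- by rewrite ltey_eq fin_num_measure.
- exact: measurable_funTS.
- exists M; split; first exact: num_real.
  by move=> x Mx z Dz; apply: le_trans (GM _ Dz) (ltW Mx).
Qed.

Lemma sum_pmf_le (F : 'I_N.+1 -> R) (G : R -> R) :
  mu.-integrable setT (EFin \o G) ->
  (forall x, 0 <= x <= 1 -> F (quantize x) <= G x) ->
  \sum_b pmf mu b * F b <= fine (\int[mu]_x (G x)%:E)%E.
Proof.
move=> iG FG; rewrite -lee_fin fineK; last exact: integrable_fin_num iG.
rewrite -integral_quantize (integralD_supp (integrable_quantize F)).
rewrite (integralD_supp iG); apply: le_integral => //.
- exact: integrableS (integrable_quantize F).
- exact: integrableS iG.
- by move=> x; rewrite inE => Dx; rewrite lee_fin FG.
Qed.

Lemma le_sum_pmf (F : 'I_N.+1 -> R) (G : R -> R) :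
  mu.-integrable setT (EFin \o G) ->
  (forall x, 0 <= x <= 1 -> G x <= F (quantize x)) ->
  fine (\int[mu]_x (G x)%:E)%E <= \sum_b pmf mu b * F b.
Proof.
move=> iG GF; rewrite -lee_fin fineK; last exact: integrable_fin_num iG.
rewrite -integral_quantize (integralD_supp (integrable_quantize F)).
rewrite (integralD_supp iG); apply: le_integral => //.
- exact: integrableS iG.
- exact: integrableS (integrable_quantize F).
- by move=> x; rewrite inE => Dx; rewrite lee_fin GF.
Qed.

Let integrable_id : mu.-integrable setT (EFin \o @id R).
Proof.
apply: (@integrable_supported _ 1); first exact: measurable_id.
by move=> x /andP[x0 x1]; rewrite ger0_norm.
Qed.

Lemma quantize_mean :
  \sum_b pmf mu b * grid b <= dmean mu <= \sum_b pmf mu b * grid b + N%:R^-1.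
Proof.
apply/andP; split.
  apply: (sum_pmf_le integrable_id) => x x01.
  by case/andP: (grid_quantize x01).
have := le_sum_pmf (F := fun b => grid b + N%:R^-1) integrable_id.
under eq_bigr do rewrite mulrDr.
rewrite big_split /= -mulr_suml pmf_sum1 mul1r; apply=> x x01.
by case/andP: (grid_quantize x01).
Qed.

(** Moving the centre from the mean of the rounded law to [dmean mu] can only increase the second
    moment; then [(g - c)^2 <= 2 (x - c)^2 + 2 (x - g)^2], with rounding error at most [1 / N]. *)
Lemma quantize_var :
  \sum_b pmf mu b * (grid b - \sum_b pmf mu b * grid b) ^+ 2
  <= 2 * dvar mu + 2 * N%:R^-1 ^+ 2.
Proof.
set m := \sum_b _ * grid b.
have /andP[m0 m1] := quantize_mean.
set c := dmean mu in m0 m1 *; rewrite -/m in m0 m1.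
have h1 : \sum_b pmf mu b * (grid b - m) ^+ 2 <= \sum_b pmf mu b * (grid b - c) ^+ 2.
  rewrite -subr_ge0 -sumrB.
  rewrite (eq_bigr (fun b => (c ^+ 2 - m ^+ 2) * pmf mu b +
    2 * (m - c) * (pmf mu b * grid b))); last by move=> b _; ring.
  rewrite big_split /= -!big_distrr /= pmf_sum1 -/m.
  by have := sqr_ge0 (m - c); lra.
apply: le_trans h1 _.
have iV : mu.-integrable setT (EFin \o (fun x : R => (x - c) ^+ 2)).
  apply: (@integrable_supported _ ((1 + `|c|) ^+ 2)).
    by apply: measurable_funX; apply: measurable_funB.
  move=> x /andP[x0 x1]; rewrite normrX lerXn2r ?nnegrE ?addr_ge0 //.
  by apply: le_trans (ler_normB _ _) _; rewrite lerD2r ger0_norm.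
have := sum_pmf_le (F := fun b => (grid b - c) ^+ 2 / 2 - N%:R^-1 ^+ 2) iV.
rewrite -/(dvar mu).
have -> : \sum_b pmf mu b * ((grid b - c) ^+ 2 / 2 - N%:R^-1 ^+ 2) =
    (\sum_b pmf mu b * (grid b - c) ^+ 2) / 2 - N%:R^-1 ^+ 2.
  under eq_bigr do rewrite mulrBr mulrA.
  by rewrite sumrB -!mulr_suml pmf_sum1 mul1r.
move=> h; have {}h : (\sum_b pmf mu b * (grid b - c) ^+ 2) / 2 - N%:R^-1 ^+ 2 <= dvar mu.
  apply: h => x x01; have /andP[g0 g1] := grid_quantize x01.
  set g := grid _ in g0 g1 *; set v := N%:R^-1 in g1 *.
  have h2 : (x - g) ^+ 2 <= v ^+ 2 by rewrite lerXn2r ?nnegrE ?subr_ge0 ?invr_ge0 //; lra.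
  have := sqr_ge0 (g - c - 2 * (x - c)); nra.
lra.
Qed.

End Quantization.

(** * From decision trees to policies *)

Section Replay.
Variables (R : realType) (k N : nat).
Hypothesis N_gt0 : (0 < N)%N.
Local Notation program := (prog 'I_k.+1 'I_N.+1).

(** Only the rewards steer the tree: in a history produced by the policy, the arms are those the
    tree asked for. *)
Fixpoint replay (t : program 'I_k.+1) (h : hist R k) {struct h} : program 'I_k.+1 :=
  if h is x :: h' then
    if t is Draw i g then replay (g (quantize N x.2)) h' else t
  else t.

Definition policy_of (t : program 'I_k.+1) : policy R k := fun h a =>
  match replay t h with
  | Ret j => (a == inr j)%:R
  | Draw i _ => (a == inl i)%:R
  end.

Lemma sum_point (T : finType) (c : T) : \sum_(a : T) (a == c)%:R = 1 :> R.
Proof. by rewrite (bigD1 c) //= eqxx big1 ?addr0 // => a /negbTE ->. Qed.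

Lemma policy_of_valid t : valid_policy (policy_of t).
Proof.
by move=> h; rewrite /policy_of; case: (replay t h) => [j|i g];
  (split=> [a|]; [exact: ler0n | exact: sum_point]).
Qed.

Lemma replay_rcons t h z : replay t (rcons h z) =
  if replay t h is Draw i g then g (quantize N z.2) else replay t h.
Proof. by elim: h t => [|x h IH] [a|i g] //=. Qed.

Variable mu : 'I_k.+1 -> probability R R.
Local Notation p := (fun i => pmf (N := N) (mu i)).

Fixpoint success (good : pred 'I_k.+1) m (t : program 'I_k.+1) {struct t} : R :=
  match t, m with
  | Ret a, _ => (good a)%:R
  | Draw i g, m'.+1 => \sum_b p i b * success good m' (g b)
  | Draw i g, 0%N => 0
  end.

(** The tree sees a reward only through [quantize], so each integral collapses to a finite sum over
    the grid. *)
Lemma succ_withinE t eps m h :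
  succ_within (policy_of t) mu eps m h =
  (success (eps_good mu eps) m (replay t h))%:E.
Proof.
have point (c : action k) (f : action k -> \bar R) :
    (\sum_(a : action k) ((a == c)%:R)%:E * f a = f c)%E.
  rewrite (bigD1 c) //= eqxx mul1e big1 ?adde0 // => a /negbTE ->.
  by rewrite mul0e.
elim: m h => [|m IH] h /=; rewrite /policy_of; case E: (replay t h) => [j|i g];
  rewrite point //=.
under eq_integral do rewrite IH replay_rcons E /=.
by rewrite (integral_quantize N_gt0 (mu i) (fun b => success _ m (g b))).
Qed.

(** A cheap output certifies at most [m] draws, so cutting the run off after [m] draws loses no
    cheap outcome; where the cutoff strikes, the left-hand side is 0. *)
Lemma success_ge A (t : program A) (o : A -> 'I_k.+1) (good : pred 'I_k.+1)
    (cheap : pred A) m :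
  always t (fun n a => cheap a -> n <= m)%N ->
  pr p t (fun a => good (o a) && cheap a) <=
  success good m (bind t (fun a => Ret (o a))).
Proof.
rewrite /pr; have p0 i b : 0 <= p i b by exact: pmf_ge0.
elim: t m => [a|i g IH] m /= tQ; first by rewrite ler_nat; case: (good _); case: (cheap a).
case: m tQ => [|m] tQ; last by apply: ler_sum => b _; rewrite ler_wpM2l // IH.
rewrite big1 // => b _; apply/eqP; rewrite mulf_eq0; apply/orP; right.
rewrite eq_le (ex_ge0 p0 _) ?andbT //; last first.
  by move=> i'; apply: pmf_sum1.
rewrite -[leRHS](ex_cst (p := p) _ (g b)); last by move=> i'; apply: pmf_sum1.
apply: (ex_le_always p0 (tQ b)) => n a; case: (cheap a) => [/(_ isT)//|_].
by rewrite andbF.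
Qed.

End Replay.

(** * Choice of constants *)

Section Constants.
Variable R : realType.
Implicit Types eps delta : R.

Lemma expR1_ge2 : 2 <= expR 1 :> R.
Proof. by apply: le_trans (expR_ge1Dx 1). Qed.

Lemma expR_LL (x : R) : 1 <= x -> expR (LL x) = expR 1 + ln x.
Proof.
move=> x1; rewrite lnK // posrE; have := ln_ge0 x1; have := expR1_ge2; lra.
Qed.

Lemma LL_ge1 (x : R) : 1 <= x -> 1 <= LL x.
Proof.
by move=> x1; rewrite -ler_expR expR_LL // lerDl ln_ge0.
Qed.

(** Since [expR 2^-1 <= 2], more than [2 * ln eps^-1] doublings reach [eps^-1]; five more give
    [32 / 8 = 4]. *)
Lemma exists_depth eps : 0 < eps < 1 ->
  exists L : nat, L%:R <= 2 * ln eps^-1 + 6 /\ 4 <= 2 ^+ L * (eps / 8).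
Proof.
move=> /andP[e0 e1]; have i1 : 1 <= eps^-1 by rewrite invf_ge1 // ltW.
have x0 : 0 <= 2 * ln eps^-1 by rewrite mulr_ge0 ?ln_ge0.
have /andP[t0 t1] := truncn_itv x0; set t := Num.truncn _ in t0 t1.
exists (t.+1 + 5)%N; split; first by rewrite natrD -natr1; lra.
have h : expR 2^-1 <= 2 :> R.
  have a0 : 0 < expR 2^-1 :> R by exact: expR_gt0.
  have := expR_ge1Dx (- 2^-1 : R); rewrite expRN => h.
  have := ler_wpM2r (ltW a0) h; rewrite mulVf ?gt_eqF //; lra.
have h2 : eps^-1 <= 2 ^+ t.+1.
  apply: (@le_trans _ _ (expR 2^-1 ^+ t.+1)); last by rewrite lerXn2r ?nnegrE ?expR_ge0.
  rewrite -expRM_natl -[leLHS]lnK ?posrE ?invr_gt0 // ler_expR.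
  by move: t1; lra.
have h3 := ler_wpM2r (ltW e0) h2; rewrite mulVf ?gt_eqF // in h3.
rewrite exprD; move: (2 ^+ t.+1) h3 => P h3.
have -> : P * 2 ^+ 5 * (eps / 8) = P * eps * 4 by field.
by clear h2; move: (P * eps) h3 => Q h3; lra.
Qed.

(** [expR (LL eps^-1)] is [expR 1 + ln eps^-1], which absorbs the number of levels. As [LL] is at
    least 1, the factor 12 leaves a spare [expR (- 11)], and [expR 11 >= 2 ^ 11] beats the constant
    534. *)
Lemma confidence_suffices eps delta (L : nat) :
  0 < eps < 1 -> 0 < delta <= 2^-1 -> L%:R <= 2 * ln eps^-1 + 6 ->
  (2 * L%:R + 522) * expR (- (12 * (ln delta^-1 + LL eps^-1))) <= delta.
Proof.
move=> /andP[e0 e1] /andP[d0 d1] hL.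
have i1 : 1 <= eps^-1 by rewrite invf_ge1 // ltW.
have j1 : 1 <= delta^-1 by rewrite invf_ge1 //; lra.
have a0 := ln_ge0 j1; have L1 := LL_ge1 i1; have x0 := ln_ge0 i1.
have w2 := expR1_ge2; set w := expR 1 + ln eps^-1.
have w0 : 0 < w by rewrite /w; lra.
have [c [c534 c11]] : exists c : R, 534 <= c /\ c <= expR 11.
  exists (2 ^+ 11); split; first by rewrite -natrX ler_nat.
  by rewrite -[X in expR X]mulr1 expRM_natl lerXn2r ?nnegrE ?expR_ge0.
have c0 : 0 < c by apply: lt_le_trans c534; rewrite ltr0n.
have e11 : expR (- 11) <= c^-1 by rewrite expRN lef_pV2 ?posrE ?expR_gt0.
have hE : expR (- (12 * (ln delta^-1 + LL eps^-1))) <= delta * w^-1 * c^-1.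
  apply: (@le_trans _ _ (expR (- ln delta^-1 + - LL eps^-1 + - 11))).
    by rewrite ler_expR; lra.
  rewrite !expRD !expRN lnK ?posrE ?invr_gt0 // invrK expR_LL // -/w -expRN.
  by rewrite ler_wpM2l // mulr_ge0 ?invr_ge0 // ltW.
have hL2 : 2 * L%:R + 522 <= 534 * w by rewrite /w; lra.
apply: le_trans (ler_pM _ _ hL2 hE) _.
- by apply: addr_ge0; [apply: mulr_ge0|]; exact: ler0n.
- exact: expR_ge0.
have -> : 534 * w * (delta * w^-1 * c^-1) = delta * (534 / c).
  by field; rewrite !gt_eqF.
apply: ler_piMr; first exact: ltW.
by rewrite ler_pdivrMr // mul1r.
Qed.

End Constants.

(** The rounding error in the variance is of order [eps ^+ 2], so it adds only a multiple of [l],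
    absorbed by [l / eps]. *)
Lemma arm_cost_le (R : realType) (n : nat) (batch eps l v dv Ni : R) :
  0 < eps < 1 -> 1 <= l -> n%:R <= 16 * l / (eps / 8) + 1 ->
  0 <= Ni <= eps / 8 -> v <= 2 * dv + 2 * Ni ^+ 2 ->
  batch <= n%:R + 128 * v * l / (eps / 8) ^+ 2 ->
  batch <= 128 * (128 * (l * (dv / eps ^+ 2 + eps^-1))).
Proof.
move=> /andP[e0 e1] l1 hn /andP[N0 N1] hv hb.
have i1 : 1 <= eps^-1 by rewrite invf_ge1 // ltW.
have l0 : 0 <= l by lra.
have hN : Ni ^+ 2 <= eps ^+ 2 / 64.
  have -> : eps ^+ 2 / 64 = (eps / 8) ^+ 2 by field.
  by rewrite lerXn2r ?nnegrE //; lra.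
have {hv} hv : v <= 2 * dv + eps ^+ 2 / 32 by lra.
have hq : 128 * v * l / (eps / 8) ^+ 2 <= 128 * (128 * (l * (dv / eps ^+ 2)) + 2 * l).
  have -> : 128 * v * l / (eps / 8) ^+ 2 = 128 * (64 * (l / eps ^+ 2) * v).
    by field; rewrite gt_eqF.
  rewrite ler_wpM2l ?ler0n //.
  have -> : 128 * (l * (dv / eps ^+ 2)) + 2 * l =
      64 * (l / eps ^+ 2) * (2 * dv + eps ^+ 2 / 32).
    by field; rewrite gt_eqF.
  apply: ler_wpM2l => //; apply: mulr_ge0; first exact: ler0n.
  by apply: divr_ge0 => //; exact: sqr_ge0.
have hn2 : 16 * l / (eps / 8) + 1 <= 129 * (l * eps^-1).
  have -> : 16 * l / (eps / 8) = 128 * (l * eps^-1) by field; rewrite gt_eqF.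
  by have := ler_pM ler01 ler01 l1 i1; rewrite mulr1; lra.
have h1 : l <= l * eps^-1 by rewrite ler_peMr.
rewrite mulrDr mulrDr; lra.
Qed.

(** * Assembling the policy and its cost bound *)

Theorem theorem4p1 (R : realType) :
  exists C : R, 0 < C /\
  forall (k : nat) (eps delta : R),
    0 < eps < 1 -> 0 < delta <= 2^-1 ->
    exists pol : policy R k, valid_policy pol /\
    forall mu : 'I_k.+1 -> probability R R,
      (forall i, supported01 (mu i)) ->
      exists m : nat,
        m%:R <= C * \sum_(i < k.+1)
                     ((dvar (mu i) / eps ^+ 2 + eps^-1) *
                      (ln (delta^-1) + LL (eps^-1))) /\
        ((1 - delta)%:E <= succ_within pol mu eps m [::])%E.
Proof.
have reassoc (a b c : nat) : (a * b * (2 * c) = a * 2 * (c * b))%N by lia.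
pose K : nat := (4 + 16 * 522)%N.
(* [K] comes from [solve_cost], 2 from Markov's inequality for the weight, [128 * 128] from
   [arm_cost_le], and 12 from [l = 12 * conf]. *)
exists (K%:R * 2 * 128 * 128 * 12); split.
  by rewrite !mulr_gt0 ?ltr0n.
move=> k eps delta eps01 delta01.
have /andP[e0 e1] := eps01; have /andP[d0 d1] := delta01.
have i1 : 1 <= eps^-1 by rewrite invf_ge1 // ltW.
have j1 : 1 <= delta^-1 by rewrite invf_ge1 //; lra.
set conf := ln _ + _.
have conf1 : 1 <= conf by rewrite /conf; have := ln_ge0 j1; have := LL_ge1 i1; lra.
pose l := 12 * conf; pose e := eps / 8.
have l1 : 1 <= l by rewrite /l; lra.
have ep : 0 < e by rewrite divr_gt0.
have [L [hL L_large]] := exists_depth eps01.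
pose N := (Num.truncn e^-1).+1.
have N_gt0 : (0 < N)%N by [].
have Ni : 0 <= (N%:R^-1 : R) <= e.
  apply/andP; split; first by rewrite invr_ge0 ler0n.
  rewrite -[leRHS]invrK lef_pV2 ?posrE ?invr_gt0 ?ltr0n //.
  exact/ltW/truncnS_gt.
have x0 : 0 <= 16 * l / e by rewrite divr_ge0 ?(ltW ep) // mulr_ge0 //; lra.
pose n := (Num.truncn (16 * l / e)).+1.
have n_large : 16 * l <= n%:R * e by rewrite -ler_pdivrMr //; exact/ltW/truncnS_gt.
have n_small : n%:R <= 16 * l / e + 1.
  by rewrite /n -natr1 lerD2r; case/andP: (truncn_itv x0).
pose t := solve (@grid R N) n e l L (@ord0 k).
exists (policy_of (bind t (fun a => Ret a.1))); split; first exact: policy_of_valid.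
move=> mu mu01.
pose p i := pmf (N := N) (mu i).
have p0 i b : 0 <= p i b by exact: pmf_ge0.
have p1 i : \sum_b p i b = 1 by apply: pmf_sum1.
have y01 := @grid01 R N N_gt0.
have [b hb] : exists b, forall i, theta mu i <= theta mu b.
  exists [arg max_(i > ord0) theta mu i]%O => i.
  by case: arg_maxP => // j _; apply.
have maxE : maxtheta mu = theta mu b.
  apply/le_anti/andP; split; last exact: le_bigmax.
  by apply/bigmax_leP; split=> // i _.
have [kk hkk] := choice (exists_level (@grid R N) p0 ep l1 n_large).
pose W := (\sum_(i <- enum 'I_k.+1) 2 ^ kk i)%N.
exists (K * n * (2 * W))%N; split.
  have -> : (K * n * (2 * W))%:R = K%:R * 2 * \sum_(i < k.+1) (batch n (kk i))%:R :> R.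
    rewrite -natr_sum -natrM -natrM; congr _%:R.
    by rewrite /batch -big_distrl /= /W big_enum /= reassoc.
  rewrite -!mulrA ler_wpM2l ?ler0n // ler_wpM2l ?ler0n //.
  rewrite !big_distrr /=; apply: ler_sum => i _.
  have [_ hi] := hkk i.
  have hv := quantize_var N_gt0 (mu01 i).
  apply: le_trans (arm_cost_le eps01 l1 n_small Ni hv hi) _.
  by rewrite le_eqVlt /l; apply/orP; left; apply/eqP; ring.
rewrite (succ_withinE N_gt0) lee_fin.
pose cheap (a : 'I_k.+1 * nat) := (a.2 <= 2 * W)%N.
apply: le_trans (success_ge N_gt0 mu (cheap := cheap) _ _ _); last first.
  apply: always_impl (solve_cost _ _ _ _ _ _) => m a ma ca.
  by apply: leq_trans ma _; rewrite leq_mul2l; apply/orP; right.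
have hf := solve_fails y01 ord0 p0 p1 ep l1 n_large L_large b (fun i => proj1 (hkk i)).
rewrite (prC p0 p1) lerD2l lerN2; apply: le_trans (confidence_suffices eps01 delta01 hL).
apply: le_trans hf; apply: pr_le => // a; apply: contra => /andP[good_a ca].
apply/andP; split; last exact: ca.
(* Error budget: [5 * e] from the algorithm and at most [e] from rounding, in total
   [6 * eps / 8]. *)
have /andP[ma1 ma2] := quantize_mean N_gt0 (mu01 a.1).
have /andP[mb1 mb2] := quantize_mean N_gt0 (mu01 b).
rewrite /eps_good maxE distrC ger0_norm ?subr_ge0 ?hb //.
move: good_a; rewrite /mean /theta /p; have /andP[_ N1] := Ni.
rewrite /e in N1 *; lra.
Qed.
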